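(* Let $T_{n,g}$ be a random generalized Toeplitz matrix with input sequences $\{a_{j,n}\}_{j\in\mathbb{Z}}$, $\{b_{j,n}\}_{j\in\mathbb{Z}}$ satisfying assumption (B) stated in the context, and put $B_{n,1}=n^{-1/2}T_{n,g}$. For $i=1,\ldots,m$, let $B_{n,1}^{(i)}$ be independent copies of $B_{n,1}$ and let $B_{n,2}^{(i)}=D_{n,g}^{(i)}$ be $m$ deterministic generalized Toeplitz matrices whose two input sequences $\{d'^{(i)}_k\}_{k\in\mathbb{Z}}$, $\{d''^{(i)}_k\}_{k\in\mathbb{Z}}$ of complex numbers are absolutely summable: $\sum_{k=-\infty}^{\infty}|d'^{(i)}_k|<\infty$ and $\sum_{k=-\infty}^{\infty}|d''^{(i)}_k|<\infty$. Let $P_n$ be the $n\times n$ backward identity permutation matrix. Then, as $n\to\infty$, $\{P_n,B_{n,j}^{(i)};1\le j\le2,1\le i\le m\}$ converge jointly (in $*$-distribution). In particular, $\{P_n,n^{-1/2}T_{n,g},D_{n,g}\}$ converge jointly, where $D_{n,g}$ is a deterministic generalized Toeplitz matrix with absolutely summable input sequences.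
   Context: The generalized Toeplitz matrix with input sequences $(a_k)_{k\in\mathbb{Z}}$, $(b_k)_{k\in\mathbb{Z}}$ is the $n\times n$ matrix $((t_{i,j}))$ with $t_{i,j}=a_{i-j}$ if $i+j\le n$ and $t_{i,j}=b_{i-j}$ if $i+j\ge n+1$. For the random matrix $T_{n,g}$ the inputs are $a_k=a_{k,n}$, $b_k=b_{k,n}$. For the deterministic matrix $D_{n,g}$, the sequences $a$ and $b$ are replaced by two sequences of complex numbers $d'=(d'_k)_{k\in\mathbb{Z}}$ and $d''=(d''_k)_{k\in\mathbb{Z}}$. Assumption (B): the pairs $(a_{j,n}=x_{j,n}+\mathrm{i}y_{j,n},\ b_{j,n}=x'_{j,n}+\mathrm{i}y'_{j,n})$, $j\in\mathbb{Z}$ (with $x,y,x',y'$ real), are independent across $j$; the complex random variables $a_{j,n},b_{j,n}$ have mean zero and variance one ($\mathbf{E}|a_{j,n}|^2=\mathbf{E}|b_{j,n}|^2=1$); and $\{(x_{j,n},y_{j,n},x'_{j,n},y'_{j,n});j\in\mathbb{Z}\}$ have the following correlation, with constants $\rho_1,\ldots,\rho_6$: (i) $\mathbf{E}[x_{j,n}y_{j,n}]=\rho_1$, $\mathbf{E}[x_{j,n}x'_{j,n}]=\rho_2$, $\mathbf{E}[x_{j,n}y'_{j,n}]=\rho_3$, $\mathbf{E}[x'_{j,n}y_{j,n}]=\rho_4$, $\mathbf{E}[x'_{j,n}y'_{j,n}]=\rho_5$, $\mathbf{E}[y_{j,n}y'_{j,n}]=\rho_6$; (ii) $\sup_{j,n}\{\mathbf{E}(|x_{j,n}|^k),\mathbf{E}(|y_{j,n}|^k),\mathbf{E}(|x'_{j,n}|^k),\mathbf{E}(|y'_{j,n}|^k)\}\le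 c_k<\infty$ for all $k\ge1$. The backward identity permutation matrix $P_n$ has $(i,j)$ entry $1$ if $i+j=n+1$ and $0$ otherwise. For an $n\times n$ random matrix $B$ whose entries have all moments finite, $\varphi_n(B)=\frac1n\mathbf{E}[\mathrm{Tr}(B)]$. For a matrix $B$, $B^1=B$ and $B^*$ is the conjugate transpose. A finite family of sequences of $n\times n$ matrices $\{A_{i,n}\}_{i\in I}$ converges jointly (in $*$-distribution) if for every $k\ge1$, all $i_1,\ldots,i_k\in I$ and all $\epsilon_1,\ldots,\epsilon_k\in\{1,*\}$ the limit $\lim_{n\to\infty}\varphi_n(A_{i_1,n}^{\epsilon_1}\cdots A_{i_k,n}^{\epsilon_k})$ exists (and is finite); these limits then define the $*$-moments of limit elements in a $*$-probability space, i.e. a unital $*$-algebra over the complex numbers with a linear functional $\varphi$ satisfying $\varphi(\mathbf{1})=1$ and $\varphi(aa^* )\ge0$ for all $a$.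
   Formalization: The formal theorem also assumes that the second moments of the real parts, E[x_{j,n}^2] and E[x'_{j,n}^2], are constants independent of j and n; under assumption (B) alone E[a_{j,n}^2] may oscillate with n and some joint moments then fail to converge. *)

(* Defs.v *)
From HB Require Import structures.
From mathcomp Require Import all_boot all_order all_algebra.
From mathcomp Require Import complex.
From mathcomp Require Import all_classical all_reals all_analysis.

Set Implicit Arguments.
Unset Strict Implicit.
Unset Printing Implicit Defensive.

Import Order.TTheory GRing.Theory Num.Theory numFieldNormedType.Exports.
Local Open Scope classical_set_scope.
Local Open Scope ring_scope.
Local Open Scope complex_scope.

(* Ordinals are 0-based: row i and column j carry the 1-based labels i.+1 and
   j.+1, so i + j <= n for the labels reads i.+1 + j.+1 <= n. *)
Definition gtoeplitz (R : realType) (n : nat) (a b : int -> R[i]) :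
    'M[R[i]]_n :=
  \matrix_(i < n, j < n)
    if (i.+1 + j.+1 <= n)%N then a (i%:Z - j%:Z) else b (i%:Z - j%:Z).

Definition backward_id (R : realType) (n : nat) : 'M[R[i]]_n :=
  \matrix_(i < n, j < n) (i.+1 + j.+1 == n.+1)%:R.

Definition adjoint (R : realType) (n : nat) (M : 'M[R[i]]_n) : 'M[R[i]]_n :=
  map_mx Num.conj M^T.

Definition abs_summable (R : realType) (d : int -> R[i]) : Prop :=
  summable [set: int] (fun k => (Normc.normc (d k))%:E).

(* [g_sigma_algebraType] needs a pointed carrier. *)
HB.instance Definition _ (R : realType) := isPointed.Build R[i] 0.

(* The sigma-algebra on matrices generated by the real and imaginary parts of
   the entries; it is the Borel sigma-algebra. *)
Definition mx_cylinders (R : realType) (n : nat) : set (set 'M[R[i]]_n) :=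
  [set A | exists (i j : 'I_n) (U : set R), measurable U /\
     (A = [set M : 'M[R[i]]_n | U (complex.Re (M i j))] \/
      A = [set M : 'M[R[i]]_n | U (complex.Im (M i j))])].

Definition mx_space (R : realType) (n : nat) :=
  g_sigma_algebraType (@mx_cylinders R n).

Section Probability.
Context (d : measure_display) (T : measurableType d) (R : realType).
Variable P : probability T R.

Definition cexpectation (Z : T -> R[i]) : R[i] :=
  fine ('E_P[fun w => complex.Re (Z w)])%E +i*
  fine ('E_P[fun w => complex.Im (Z w)])%E.

Definition phi (n : nat) (M : T -> 'M[R[i]]_n) : R[i] :=
  n%:R^-1 * cexpectation (fun w => \tr (M w)).

Definition mutually_independent (I : eqType) (d' : measure_display)
    (S : measurableType d') (X : I -> T -> S) : Prop :=
  forall (s : seq I) (A : I -> set S), uniq s ->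
    (forall i, measurable (A i)) ->
    (P (\bigcap_(i in [set` s]) (X i @^-1` A i)) =
     \prod_(i <- s) P (X i @^-1` A i))%E.

Definition same_law (d' : measure_display) (S : measurableType d')
    (X Y : T -> S) : Prop :=
  forall A : set S, measurable A -> P (X @^-1` A) = P (Y @^-1` A).

Definition independent_copies (I : eqType) (d' : measure_display)
    (S : measurableType d') (X : I -> T -> S) (Y : T -> S) : Prop :=
  [/\ forall i, measurable_fun [set: T] (X i),
      forall i, same_law (X i) Y
    & mutually_independent X].

Definition cRV (x y : {RV P >-> R}) (w : T) : R[i] := x w +i* y w.

(* The inputs are a_{j,n} = x n j + i * y n j and b_{j,n} = x' n j + i * y' n j.
   The bounds in [B_moments] may depend on k but not on n and j. *)
Record assumption_B (x y x' y' : nat -> int -> {RV P >-> R})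
    (rho1 rho2 rho3 rho4 rho5 rho6 : R) : Prop := {
  B_indep : forall n, mutually_independent
    (fun (j : int) (w : T) => ((x n j w, y n j w), (x' n j w, y' n j w)));
  B_mean_a : forall n j, cexpectation (cRV (x n j) (y n j)) = 0;
  B_mean_b : forall n j, cexpectation (cRV (x' n j) (y' n j)) = 0;
  B_var_a : forall n j,
    ('E_P[fun w => (Normc.normc (cRV (x n j) (y n j) w) ^+ 2)%R] = 1)%E;
  B_var_b : forall n j,
    ('E_P[fun w => (Normc.normc (cRV (x' n j) (y' n j) w) ^+ 2)%R] = 1)%E;
  B_rho1 : forall n j, ('E_P[fun w => (x n j w * y n j w)%R] = rho1%:E)%E;
  B_rho2 : forall n j, ('E_P[fun w => (x n j w * x' n j w)%R] = rho2%:E)%E;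
  B_rho3 : forall n j, ('E_P[fun w => (x n j w * y' n j w)%R] = rho3%:E)%E;
  B_rho4 : forall n j, ('E_P[fun w => (x' n j w * y n j w)%R] = rho4%:E)%E;
  B_rho5 : forall n j, ('E_P[fun w => (x' n j w * y' n j w)%R] = rho5%:E)%E;
  B_rho6 : forall n j, ('E_P[fun w => (y n j w * y' n j w)%R] = rho6%:E)%E;
  B_moments : forall k, (1 <= k)%N -> exists c : R, forall n j,
    [/\ ('E_P[fun w => (`|x n j w| ^+ k)%R] <= c%:E)%E,
        ('E_P[fun w => (`|y n j w| ^+ k)%R] <= c%:E)%E,
        ('E_P[fun w => (`|x' n j w| ^+ k)%R] <= c%:E)%E
      & ('E_P[fun w => (`|y' n j w| ^+ k)%R] <= c%:E)%E] }.

(* The second moments E[x^2] and E[x'^2], like the correlations rho1, ..., rho6,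
   do not depend on j and n; E[y^2] and E[y'^2] are then constant too, since
   E|a|^2 = E|b|^2 = 1.  [assumption_B] alone leaves the pseudo-variances
   E[a_{j,n}^2] and E[b_{j,n}^2] free, and these enter the limits: the limit of
   phi (T T P T T P) / n^2 contains (E[a^2])^2 with a positive coefficient.  If
   a_{j,n} is uniform on {1, -1} for even n and on {1, -1, i, -i} for odd n, and
   b_{j,n} is independent of it and uniform on {1, -1, i, -i}, then
   [assumption_B] holds with rho1 = ... = rho6 = 0, but the sequence
   oscillates. *)
Definition constant_second_moments (x x' : nat -> int -> {RV P >-> R})
    (s s' : R) : Prop :=
  forall n j, ('E_P[fun w => (x n j w ^+ 2)%R] = s%:E)%E /\
              ('E_P[fun w => (x' n j w ^+ 2)%R] = s'%:E)%E.

Definition scaled_rtoeplitz (x y x' y' : nat -> int -> {RV P >-> R}) (n : nat)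
    (w : T) : 'M[R[i]]_n :=
  ((Num.sqrt (n%:R : R))^-1)%:C *:
    gtoeplitz n (fun k => cRV (x n k) (y n k) w)
                (fun k => cRV (x' n k) (y' n k) w).

(* [eps l = true] stands for the exponent *, [eps l = false] for 1.  The alias
   R[i]^o carries the topology of the modulus. *)
Definition joint_cvg (I : finType) (A : I -> forall n, T -> 'M[R[i]]_n) :
    Prop :=
  forall (k : nat) (i : 'I_k -> I) (eps : 'I_k -> bool), (1 <= k)%N ->
    exists m : R[i],
      (fun n => phi (fun w => \prod_(l < k)
         (if eps l then adjoint (A (i l) n w) else A (i l) n w)) : R[i]^o)
        @ \oo --> (m : R[i]^o).

Definition PBD_family (I : finType) (B : I -> forall n, T -> 'M[R[i]]_n)
    (D : I -> forall n, 'M[R[i]]_n) (i : option (I + I)%type) (n : nat) (w : T) :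
    'M[R[i]]_n :=
  match i with
  | None => backward_id R n
  | Some (inl i) => B i n w
  | Some (inr i) => D i n
  end.

End Probability.

(* Main.v *)
Require Import Defs.
From HB Require Import structures.
From mathcomp Require Import all_boot all_order all_algebra.
From mathcomp Require Import complex.
From mathcomp Require Import all_classical all_reals all_analysis.
From mathcomp Require Import measurable_realfun ring lra zify.

(** The proof is the method of moments, organized so that existence of the limits is
    a counting statement about lattice points.

    The average of a word is a sum over closed paths of vertices (mxtrace_paths). A
    letter T or D moves the vertex by the index at which its input sequence is read;
    P sends v to n - 1 - v, and is treated like a letter D whose path is reflected
    and whose displacement has to be 0; the letters P and D are called fixed below. A
    path is thus coded by its start and its displacements (sum_paths), and its vertices
    are affine forms in these data and in n.

    By independence, first of the copies and then of the inputs of one copy, the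
    expectation along a path factors over the blocks of random letters that read the
    same index of the same copy (random_factor_expectation). A block of one letter
    gives 0 because the inputs are centered. A pattern of r blocks has about n^(1 + r)
    choices for the start and the random displacements, and the normalization for p
    random letters is n^(- 1 - p / 2). So only the patterns made of pairs survive
    (pattern_term_bound, pattern_term_singleton), and for them the expectation depends
    only on which of the two input sequences each letter reads, because the second
    moments are constant (cexpectation_pair).

    The displacements of the fixed letters carry summable weights and can be fixed by
    dominated convergence for sums (tannery). What is left is the proportion of lattice
    points in a box of side proportional to n at which finitely many affine forms have
    prescribed signs; that the path closes up is expressed by two more such signs. This
    proportion converges (lattice_average_cconverges): multiplying the scale by q
    replaces each point by a cube of q^dim points, and the signs are constant on the
    cube except near the hyperplanes bounding the region, where there is only a
    proportion O(1 / n) of the points. Hence the scales n and q n agree up to O(1 / n)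
    uniformly in q, and the sequence is Cauchy. *)

Set Implicit Arguments.
Unset Strict Implicit.
Unset Printing Implicit Defensive.

Import Order.TTheory GRing.Theory Num.Theory numFieldNormedType.Exports.
Local Open Scope classical_set_scope.
Local Open Scope ring_scope.
Local Open Scope complex_scope.

(** * Limits of complex sequences *)

Section ComplexLimits.
Variable R : realType.
Implicit Types (u v : nat -> R[i]) (z : R[i]).
Local Notation normc := (@Normc.normc R).

Lemma normc_ge0 z : 0 <= normc z.
Proof. by rewrite -ler0c; exact: (normr_ge0 z). Qed.

Lemma normc_real (a : R) : normc a%:C = `|a|.
Proof. by rewrite /= expr0n addr0 sqrtr_sqr. Qed.

Lemma ler_normcB z1 z2 : normc (z1 - z2) <= normc z1 + normc z2.
Proof. by rewrite (le_trans (le_normcD _ _))// normcN. Qed.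

Lemma normc_distC z1 z2 : normc (z1 - z2) = normc (z2 - z1).
Proof. by rewrite -normcN opprB. Qed.

Lemma ler_normc_sum (I : Type) (r : seq I) (Q : pred I) (F : I -> R[i]) :
  normc (\sum_(i <- r | Q i) F i) <= \sum_(i <- r | Q i) normc (F i).
Proof.
elim/big_ind2: _ => [|x1 x2 y1 y2 h1 h2|//]; first by rewrite Normc.normc0.
by rewrite (le_trans (le_normcD _ _))// lerD.
Qed.

Lemma normc_prod (I : Type) (r : seq I) (Q : pred I) (F : I -> R[i]) :
  normc (\prod_(i <- r | Q i) F i) = \prod_(i <- r | Q i) normc (F i).
Proof.
elim/big_rec2: _ => [|i x y _ <-]; first by rewrite Normc.normc1.
by rewrite Normc.normcM.
Qed.

Lemma normc_ge_Re z : `|complex.Re z| <= normc z.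
Proof. by rewrite -lecR; exact: (normc_ge_Re z). Qed.

Lemma normc_ge_Im z : `|complex.Im z| <= normc z.
Proof.
case: z => a b /=; rewrite -sqrtr_sqr ler_sqrt ?addr_ge0 ?sqr_ge0//.
by rewrite lerDr sqr_ge0.
Qed.

Lemma normc_le_ReIm z : normc z <= `|complex.Re z| + `|complex.Im z|.
Proof.
rewrite -ler_sqr ?nnegrE ?addr_ge0 ?normc_ge0//; case: z => a b /=.
rewrite sqr_sqrtr ?addr_ge0 ?sqr_ge0// sqrrD !real_normK ?num_real//.
by rewrite lerD2r lerDl mulrn_wge0// mulr_ge0.
Qed.

Definition cconverges u :=
  exists l : R[i], (fun n => u n : R[i]^o) @ \oo --> (l : R[i]^o).

(** Distances are measured by the real modulus throughout, so that the
    ordered-field tactics apply to the estimates. *)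
Lemma cconvergesP u (l : R[i]) :
  (fun n => u n : R[i]^o) @ \oo --> (l : R[i]^o) <->
  (forall e : R, 0 < e -> exists N, forall n, (N <= n)%N -> normc (u n - l) <= e).
Proof.
split=> [/cvgrPdist_le H e e0|H].
  have /H[N _ HN] : 0 < e%:C by rewrite ltcR.
  exists N => n /HN /=; rewrite -lecR; rewrite -normrN opprB; exact.
apply/cvgrPdist_le => e e0.
have eR : e = (complex.Re e)%:C by rewrite RRe_real// gtr0_real.
have [|N HN] := H (complex.Re e); first by rewrite -ltcR -eR.
exists N => // n /HN /=; rewrite -lecR -eR -normrN opprB; exact.
Qed.

Lemma cconverges_cauchy u :
  (forall e : R, 0 < e ->
    exists N, forall n m, (N <= n)%N -> (N <= m)%N -> normc (u n - u m) <= e) ->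
  cconverges u.
Proof.
move=> H.
have part (f : R[i] -> R) : (forall z1 z2, f (z1 - z2) = f z1 - f z2) ->
    (forall z, `|f z| <= normc z) -> cvgn (f \o u).
  move=> fB fle; apply/cauchy_cvgP/cauchy_exP => e e0.
  have [|N HN] := H (e / 2); first by rewrite divr_gt0.
  exists (f (u N)); exists N => // n /= Nn.
  rewrite /ball/= -fB (le_lt_trans (fle _))//.
  by rewrite (le_lt_trans (HN _ _ _ _))// ltr_pdivrMr// ltr_pMr// ltr1n.
have /cvg_ex[/= a /cvgrPdist_le Ha] : cvgn (@complex.Re R \o u).
  by apply: part; [by move=> [? ?] [? ?]|exact: normc_ge_Re].
have /cvg_ex[/= b /cvgrPdist_le Hb] : cvgn (@complex.Im R \o u).
  by apply: part; [by move=> [? ?] [? ?]|exact: normc_ge_Im].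
exists (a +i* b); apply/cconvergesP => e e0.
have e2 : 0 < e / 2 by rewrite divr_gt0.
have [N1 _ HN1] := Ha _ e2; have [N2 _ HN2] := Hb _ e2.
exists (maxn N1 N2) => n; rewrite geq_max => /andP[/HN1/= h1 /HN2/= h2].
rewrite normc_distC (le_trans (normc_le_ReIm _))//.
by rewrite [e]splitr lerD//; move: h1 h2; case: (u n).
Qed.

(** Uniform approximation by convergent sequences gives the Cauchy property. *)
Lemma cconverges_approx u :
  (forall e : R, 0 < e -> exists2 v, cconverges v &
    exists N, forall n, (N <= n)%N -> normc (u n - v n) <= e) ->
  cconverges u.
Proof.
move=> H; apply: cconverges_cauchy => e e0.
have e4 : 0 < e / 4 by rewrite divr_gt0.
have [v [l /cconvergesP/(_ _ e4)[N1 HN1]] [N2 HN2]] := H _ e4.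
exists (maxn N1 N2) => n m; rewrite !geq_max => /andP[n1 n2] /andP[m1 m2].
have -> : u n - u m = (u n - v n) - (u m - v m) + ((v n - l) - (v m - l)) by ring.
rewrite (le_trans (le_normcD _ _))//.
have := ler_normcB (u n - v n) (u m - v m).
have := ler_normcB (v n - l) (v m - l).
have := HN1 _ n1; have := HN1 _ m1; have := HN2 _ n2; have := HN2 _ m2; lra.
Qed.

Lemma cconverges_eventually u v N :
  (forall n, (N <= n)%N -> u n = v n) -> cconverges v -> cconverges u.
Proof.
move=> uv cv; apply: cconverges_approx => e e0; exists v => //.
by exists N => n /uv ->; rewrite subrr Normc.normc0 ltW.
Qed.

Lemma cconverges_cst z : cconverges (fun=> z).
Proof. by exists z; exact: cvg_cst. Qed.

Lemma cconvergesD u v :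
  cconverges u -> cconverges v -> cconverges (fun n => u n + v n).
Proof.
move=> [a /cconvergesP ua] [b /cconvergesP vb]; exists (a + b).
apply/cconvergesP => e e0; have e2 : 0 < e / 2 by rewrite divr_gt0.
have [N1 H1] := ua _ e2; have [N2 H2] := vb _ e2.
exists (maxn N1 N2) => n; rewrite geq_max => /andP[n1 n2].
rewrite opprD addrACA (le_trans (le_normcD _ _))// [e]splitr.
by rewrite lerD ?H1 ?H2.
Qed.

Lemma cconvergesZ z u : cconverges u -> cconverges (fun n => z * u n).
Proof.
move=> [a /cconvergesP ua]; exists (z * a); apply/cconvergesP => e e0.
have z1 : 0 < normc z + 1 by rewrite ltr_wpDl ?normc_ge0.
have [|N H] := ua (e / (normc z + 1)); first by rewrite divr_gt0.
exists N => n /H h; rewrite -mulrBr Normc.normcM.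
move: h; rewrite ler_pdivlMr// mulrC; apply: le_trans.
by rewrite ler_wpM2r ?normc_ge0// lerDl.
Qed.

Lemma cconverges_sum (I : Type) (r : seq I) (Q : pred I) (F : I -> nat -> R[i]) :
  (forall i, Q i -> cconverges (F i)) ->
  cconverges (fun n => \sum_(i <- r | Q i) F i n).
Proof.
move=> FQ; elim: r => [|i r IH].
  by apply: (cconverges_eventually (N := 0) _ (cconverges_cst 0)) => n _; rewrite big_nil.
case/boolP: (Q i) => Qi.
  apply: (cconverges_eventually (N := 0) _ (cconvergesD (FQ _ Qi) IH)) => n _.
  by rewrite big_cons Qi.
by apply: (cconverges_eventually (N := 0) _ IH) => n _; rewrite big_cons (negPf Qi).
Qed.

Lemma cconverges_to0 u (C : R) :
  (forall n, (0 < n)%N -> normc (u n) <= C / Num.sqrt n%:R) -> cconverges u.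
Proof.
move=> H; exists 0; apply/cconvergesP => e e0.
have C0 : 0 <= C.
  by have := H 1%N isT; rewrite sqrtr1 divr1; apply: le_trans; exact: normc_ge0.
exists (Num.bound ((C / e) ^+ 2)).+1 => n nb; rewrite subr0.
have n0 : (0 < n)%N by exact: leq_ltn_trans nb.
rewrite (le_trans (H n n0))// ler_pdivrMr ?sqrtr_gt0 ?ltr0n// mulrC -ler_pdivrMr//.
have -> : C / e = Num.sqrt ((C / e) ^+ 2).
  by rewrite sqrtr_sqr ger0_norm// divr_ge0// ltW.
rewrite ler_sqrt ?ler0n// ltW// (lt_le_trans (archi_boundP (sqr_ge0 _)))//.
by rewrite ler_nat ltnW.
Qed.

End ComplexLimits.

(** * Signs of affine forms on dilated boxes *)

Section LatticeCount.
Local Open Scope set_scope.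
Variable F : finType.
Implicit Types (u : F -> nat) (h : nat -> (F -> nat) -> int).

(** The box of side p * q is cut into p ^ #|F| cubes of side q. *)
Lemma sum_box_mul (V : zmodType) (p q : nat) (H : (F -> nat) -> V) :
  (0 < q)%N ->
  \sum_(w : {ffun F -> 'I_(p * q)}) H (fun x => w x) =
  \sum_(u : {ffun F -> 'I_p}) \sum_(r : {ffun F -> 'I_q})
     H (fun x => (q * u x + r x)%N).
Proof.
move=> q0; rewrite pair_big /=.
have lt1 (i : 'I_p) (j : 'I_q) : (q * i + j < p * q)%N.
  have /= := ltn_ord i; have /= := ltn_ord j; nia.
have lt2 (i : 'I_(p * q)) : (i %/ q < p)%N by rewrite ltn_divLR.
have lt3 (i : 'I_(p * q)) : (i %% q < q)%N by rewrite ltn_mod.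
pose f (z : {ffun F -> 'I_p} * {ffun F -> 'I_q}) : {ffun F -> 'I_(p * q)} :=
  [ffun x => Ordinal (lt1 (z.1 x) (z.2 x))].
pose g (w : {ffun F -> 'I_(p * q)}) :=
  ([ffun x => Ordinal (lt2 (w x))], [ffun x => Ordinal (lt3 (w x))]).
rewrite (reindex f) /=; last first.
  apply: onW_bij; exists g => [[a b]|w].
    congr pair; apply/ffunP => x; rewrite !ffunE; apply: val_inj => /=.
      by rewrite mulnC divnMDl// divn_small// addn0.
    by rewrite mulnC modnMDl modn_small.
  apply/ffunP => x; rewrite !ffunE; apply: val_inj => /=.
  by rewrite mulnC -divn_eq.
by apply: eq_bigr => -[a b] _ /=; congr H; apply/funext => x; rewrite ffunE.
Qed.

(** Affine in the point u and in the dilation parameter n at the same time; the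
    regions counted below are cut out by inequalities between such forms. *)
Definition affine h := exists (L : F -> int) (g d : int),
  forall n u, h n u = \sum_x L x * (u x)%:Z + g * n%:Z + d.

Lemma affine_cst (c : int) : affine (fun _ _ => c).
Proof.
exists (fun=> 0), 0, c => n u; by rewrite big1 ?add0r ?mul0r ?add0r.
Qed.

Lemma affine_scale : affine (fun n _ => n%:Z).
Proof.
exists (fun=> 0), 1, 0 => n u; by rewrite big1 ?add0r ?mul1r ?addr0.
Qed.

Lemma affine_coord (x : F) : affine (fun _ u => (u x)%:Z).
Proof.
exists (fun y => (y == x)%:R), 0, 0 => n u; rewrite (bigD1 x)//= eqxx mul1r.
by rewrite big1 ?mul0r ?addr0// => y /negPf ->.
Qed.

Lemma affineD h1 h2 : affine h1 -> affine h2 ->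
  affine (fun n u => h1 n u + h2 n u).
Proof.
move=> [L1 [g1 [d1 e1]]] [L2 [g2 [d2 e2]]].
exists (fun x => L1 x + L2 x), (g1 + g2), (d1 + d2) => n u; rewrite e1 e2.
under [in RHS]eq_bigr do rewrite mulrDl.
by rewrite big_split /=; ring.
Qed.

Lemma affineN h : affine h -> affine (fun n u => - h n u).
Proof.
move=> [L [g [d e]]]; exists (fun x => - L x), (- g), (- d) => n u; rewrite e.
under [in RHS]eq_bigr do rewrite mulNr.
by rewrite sumrN; ring.
Qed.

Lemma affineB h1 h2 : affine h1 -> affine h2 ->
  affine (fun n u => h1 n u - h2 n u).
Proof. by move=> a1 a2; apply: affineD => //; exact: affineN. Qed.

(** The points u whose cube, at dilation q, is not on one side of the hyperplane
    bounding the half-space at scale n. *)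
Definition sign_unstable h n q : {set {ffun F -> 'I_(2 * n)}} :=
  [set u : {ffun F -> 'I_(2 * n)} | [exists r : {ffun F -> 'I_q},
     (0 <= h (q * n)%N (fun x => (q * u x + r x)%N)) !=
     (0 <= h n (fun x => u x))]].

(** Once the other coordinates are chosen, a form of bounded value leaves only
    boundedly many choices for a coordinate with nonzero coefficient. The factor
    2 * n on both sides avoids a power with exponent #|F| - 1. *)
Lemma strip_card (L : F -> int) (g : int) (C n : nat) (x0 : F) : L x0 != 0 ->
  (#|[set u : {ffun F -> 'I_(2 * n)} |
       `|(\sum_x L x * (u x)%:Z + g * n%:Z)%R|%N <= C]| * (2 * n) <=
   (2 * C).+1 * (2 * n) ^ #|F|)%N.
Proof.
move=> L0; set S := [set u | _].
pose hh (u : {ffun F -> 'I_(2 * n)}) : int :=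
  (\sum_x L x * (u x)%:Z + g * n%:Z)%R.
(* Overwriting the coordinate x0 by a free value forgets u x0, and the value of
   the form, shifted by C to be nonnegative, restores it. *)
pose f (z : {ffun F -> 'I_(2 * n)} * 'I_(2 * n)) :
    {ffun F -> 'I_(2 * n)} * 'I_(2 * C).+1 :=
  ([ffun x => if x == x0 then z.2 else z.1 x],
   inord `|(hh z.1 + C%:Z)%R|%N).
have finj : {in finset.setX S [set: 'I_(2 * n)] &, injective f}.
  move=> [u y] [v z]; rewrite !inE/= !andbT => uS vS [/ffunP/= e1 e2].
  have yz : y = z by have := e1 x0; rewrite !ffunE eqxx.
  have uv x : x != x0 -> u x = v x.
    by move=> /negPf xx; have := e1 x; rewrite !ffunE xx.
  have huv : hh u = hh v.
    move: e2 => /(congr1 val) /=.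
    move: uS vS; rewrite -/(hh u) -/(hh v).
    move: (hh u) (hh v) => a b aC bC; rewrite !inordK; lia.
  congr pair => //; apply/ffunP => x; have [->|/uv//] := eqVneq x x0.
  apply: val_inj; apply/eqP; rewrite -eqz_nat; apply/eqP/(mulfI L0).
  move: huv; rewrite /hh (bigD1 x0)//= [in RHS](bigD1 x0)//=.
  under eq_bigr => x' x'x0 do rewrite (uv _ x'x0).
  by move=> /addIr/addIr.
have := max_card [pred z in f @: finset.setX S [set: 'I_(2 * n)]].
rewrite (card_in_imset finj) cardsX cardsT card_ord card_prod card_ffun !card_ord.
by rewrite [X in (_ <= X)%N]mulnC.
Qed.

(** Within a cube of side q the form varies by O(q), so the sign can only change if
    the form at scale n is O(1) at u, that is, in a strip around a hyperplane. A
    form that does not depend on u has no such strip: it is either constant or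
    proportional to n up to a constant, and then its sign is eventually constant. *)
Lemma sign_unstable_card h : affine h -> exists C N : nat,
  forall n q, (N <= n)%N -> (0 < q)%N ->
  (#|sign_unstable h n q| * (2 * n) <= C * (2 * n) ^ #|F|)%N.
Proof.
move=> [L [g [d hE]]].
pose C := (\sum_x `|L x| + `|d|)%N.
have bad n q u r : (0 < q)%N -> (forall x, r x < q)%N ->
    (0 <= h (q * n)%N (fun x => (q * u x + r x)%N)) != (0 <= h n u) ->
    (`|(\sum_x L x * (u x)%:Z + g * n%:Z)%R|%N <= C)%N.
  move=> q0 rq; rewrite !hE.
  have -> : \sum_x L x * (q * u x + r x)%:Z =
      q%:Z * (\sum_x L x * (u x)%:Z) + \sum_x L x * (r x)%:Z.
    rewrite mulr_sumr -big_split /=; apply: eq_bigr => x _.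
    by rewrite PoszD PoszM; ring.
  set s := \sum_x L x * (u x)%:Z; set t := \sum_x L x * (r x)%:Z.
  have tq : `|t| <= q%:Z * (\sum_x `|L x|%N)%:Z.
    rewrite (le_trans (ler_norm_sum _ _ _))// (big_morph Posz PoszD (erefl _)) mulr_sumr.
    apply: ler_sum => x _; rewrite normrM mulrC; have := rq x.
    by rewrite -abszE; nia.
  move: tq; rewrite /C; set S := (\sum_x `|L x|)%N; clearbody s t S.
  rewrite PoszM; case: leP; case: leP => //; nia.
have [[x0 L0]|L0] := pselect (exists x, L x != 0).
  exists (2 * C).+1, 0%N => n q _ q0.
  apply: leq_trans (strip_card g C n L0); rewrite leq_mul2r; apply/orP; right.
  apply/subset_leq_card/fintype.subsetP => u; rewrite !inE => /existsP[r] b.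
  exact: (bad n q (fun x => u x) (fun x => r x) q0 (fun x => ltn_ord (r x)) b).
have {}L0 x : L x = 0.
  by apply/eqP; apply: contrapT => /negP Lx; apply: L0; exists x.
exists 0%N, C.+1 => n q nC q0; rewrite mul0n leqn0 muln_eq0; apply/orP; left.
rewrite cards_eq0; apply/eqP/setP => u; rewrite !inE; apply/existsP => -[r].
move=> b; have := bad n q (fun x => u x) (fun x => r x) q0 (fun x => ltn_ord (r x)) b; move: b.
rewrite !hE !big1; [|by move=> x _; rewrite L0 mul0r..].
have [->|g0] := eqVneq g 0; first by rewrite !mul0r eqxx.
rewrite !add0r => _; have g1 : (0 < `|g|)%N by rewrite absz_gt0.
by move: C nC {hE bad} => C; nia.
Qed.

End LatticeCount.

(** * Limits of lattice averages *)

Section LatticeLimit.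
Variables (R : realType) (F X : finType) (h : X -> nat -> (F -> nat) -> int).
Variable Psi : {ffun X -> bool} -> R[i].
Hypothesis haff : forall x, affine (h x).
Local Open Scope set_scope.
Local Notation normc := (@Normc.normc R).

Let G n (u : F -> nat) : R[i] := Psi [ffun x => 0 <= h x n u].
Let A n : R[i] := n%:R^-1 ^+ #|F| * \sum_(u : {ffun F -> 'I_(2 * n)}) G n (fun x => u x).

(** Averages at scales n and q * n differ only through the unstable points, which
    are a proportion O(1 / n) of the box, uniformly in q. *)
Let lattice_scale : exists (D : R) (N : nat), forall n q, (N <= n)%N -> (0 < n)%N ->
  (0 < q)%N -> normc (A (q * n) - A n) <= D / n%:R.
Proof.
have [C /choice[N CN]] := choice (fun x => sign_unstable_card (haff x)).
pose K := \sum_s normc (Psi s).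
have K0 : 0 <= K by apply: sumr_ge0 => s _; exact: normc_ge0.
have GK n u : normc (G n u) <= K.
  rewrite /K (bigD1 [ffun x => 0 <= h x n u])//= lerDl.
  by apply: sumr_ge0 => s _; exact: normc_ge0.
exists (K * (\sum_x C x)%:R * 2 ^+ #|F|), (\max_x N x) => n q Nn n0 q0.
pose S := \bigcup_x sign_unstable (h x) n q.
have SC : (#|S| * (2 * n) <= (\sum_x C x) * (2 * n) ^ #|F|)%N.
  rewrite big_distrl /=; apply: leq_trans (_ : _ <= \sum_x #|sign_unstable (h x) n q| * (2 * n))%N _.
    rewrite -big_distrl /= leq_mul2r; apply/orP; right.
    rewrite /S; elim/big_rec2: _ => [|x a B _ aB]; first by rewrite cards0.
    by rewrite (leq_trans (leq_card_setU _ _))// leq_add2l.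
  by apply: leq_sum => x _; apply: CN => //; apply: leq_trans Nn; apply: leq_bigmax.
have -> : A (q * n) - A n = (q * n)%:R^-1 ^+ #|F| *
    \sum_(u : {ffun F -> 'I_(2 * n)}) \sum_(r : {ffun F -> 'I_q})
      (G (q * n)%N (fun x => (q * u x + r x)%N) - G n (fun x => u x)).
  rewrite /A; have -> : (2 * (q * n) = 2 * n * q)%N by rewrite mulnCA mulnC.
  rewrite sum_box_mul//; under [in RHS]eq_bigr do rewrite sumrB sumr_const.
  rewrite sumrB mulrBr; congr (_ - _); rewrite card_ffun !card_ord.
  rewrite sumrMnl -[_ *+ (q ^ _)]mulr_natr natrX [(q * n)%:R]natrM.
  rewrite !exprVn exprMn.
  have : q%:R ^+ #|F| != 0 :> R[i] by rewrite expf_neq0// pnatr_eq0 -lt0n.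
  have : n%:R ^+ #|F| != 0 :> R[i] by rewrite expf_neq0// pnatr_eq0 -lt0n.
  by move: (_ ^+ _) (_ ^+ _) (\sum_i _) => a b s a0 b0; field; apply/andP.
rewrite Normc.normcM.
have -> : normc ((q * n)%:R^-1 ^+ #|F|) = (q * n)%:R^-1 ^+ #|F| :> R.
  rewrite -[(q * n)%:R](rmorph_nat (real_complex R)) -fmorphV -rmorphXn normc_real.
  by rewrite ger0_norm// exprn_ge0// invr_ge0.
have bnd : normc (\sum_(u : {ffun F -> 'I_(2 * n)}) \sum_(r : {ffun F -> 'I_q})
      (G (q * n)%N (fun x => (q * u x + r x)%N) - G n (fun x => u x))) <=
    #|S|%:R * (q ^ #|F|)%:R * (2 * K).
  rewrite (le_trans (ler_normc_sum _ _ _))// -sum1_card natr_sum big_distrl /=.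
  rewrite big_distrl /= [leLHS](bigID (mem S)) /= [X in _ + X]big1 ?addr0; last first.
    move=> u uS; rewrite big1 ?Normc.normc0// => r _; apply/eqP; rewrite subr_eq0.
    apply/eqP; rewrite /G; congr Psi; apply/ffunP => x; rewrite !ffunE; apply/eqP.
    move: uS; apply: contraNT => hx; apply/bigcupP; exists x => //.
    by rewrite inE; apply/existsP; exists r.
  apply: ler_sum => u _; rewrite (le_trans (ler_normc_sum _ _ _))// mul1r.
  have -> : (q ^ #|F|)%:R * (2 * K) = \sum_(r : {ffun F -> 'I_q}) (2 * K).
    by rewrite sumr_const card_ffun !card_ord -[RHS]mulr_natl.
  apply: ler_sum => r _; rewrite (le_trans (ler_normcB _ _))//.
  by rewrite mulrDl !mul1r lerD.
rewrite (le_trans (ler_wpM2l _ bnd))// ?exprn_ge0 ?invr_ge0//.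
have qF : (q ^ #|F|)%:R != 0 :> R by rewrite pnatr_eq0 -lt0n expn_gt0 q0.
have n1 : 0 < n%:R :> R by rewrite ltr0n.
have -> : (q * n)%:R^-1 ^+ #|F| * (#|S|%:R * (q ^ #|F|)%:R * (2 * K)) =
    n%:R^-1 ^+ #|F| * #|S|%:R * 2 * K.
  rewrite natrM invfM exprMn [q%:R^-1 ^+ _]exprVn -natrX.
  by rewrite mulrACA [_^-1 * _]mulrC; field; rewrite qF.
rewrite ler_pdivlMr//.
have : (#|S| * (2 * n))%:R <= ((\sum_x C x) * (2 * n) ^ #|F|)%:R :> R.
  by rewrite ler_nat.
rewrite !natrM natrX natrM exprMn => SC'.
have -> : n%:R^-1 ^+ #|F| * #|S|%:R * 2 * K * n%:R =
  (n%:R^-1 ^+ #|F| * K) * (#|S|%:R * (2 * n%:R)) by ring.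
rewrite (le_trans (ler_wpM2l _ SC'))// ?mulr_ge0 ?exprn_ge0 ?invr_ge0//.
rewrite exprVn; set a := n%:R ^+ _; have a0 : a != 0 by rewrite expf_neq0// gt_eqF.
by rewrite le_eqVlt; apply/orP; left; apply/eqP; field.
Qed.

(** Comparing the scales n and m with their common multiple n * m shows that the
    averages form a Cauchy sequence. *)
Lemma lattice_average_cconverges : cconverges A.
Proof.
have [D [N DN]] := lattice_scale.
have D0 : 0 <= D.
  have := DN N.+1 1%N (leqnSn _) isT isT; rewrite mul1n subrr Normc.normc0.
  by rewrite pmulr_lge0// invr_gt0 ltr0n.
apply: cconverges_cauchy => e e0.
exists (maxn N (Num.bound (2 * D / e)).+1) => n m.
rewrite !geq_max => /andP[nN nb] /andP[mN mb].
have n0 : (0 < n)%N by exact: leq_ltn_trans nb.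
have m0 : (0 < m)%N by exact: leq_ltn_trans mb.
have -> : A n - A m = (A (n * m) - A m) - (A (m * n) - A n).
  by rewrite [(n * m)%N]mulnC; ring.
rewrite (le_trans (ler_normcB _ _))// [e]splitr.
have small k : (0 < k)%N -> (Num.bound (2 * D / e) < k)%N -> D / k%:R <= e / 2.
  move=> k0 kb; rewrite ler_pdivrMr ?ltr0n// mulrC mulrA ler_pdivlMr//.
  rewrite -ler_pdivrMr// [D * 2]mulrC ltW// (lt_le_trans (archi_boundP _))//.
    by rewrite divr_ge0 ?(ltW e0)// mulr_ge0.
  by rewrite ler_nat ltnW.
by rewrite lerD// (le_trans (DN _ _ _ _ _))// small.
Qed.

End LatticeLimit.

(** * Dominated sums over integer vectors *)

Section Tannery.
Variables (R : realType) (k : nat).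
Local Open Scope set_scope.
Local Notation normc := (@Normc.normc R).

(** Displacements lie strictly between - n and n; they are indexed by ordinals and
    shifted. *)
Definition centered n (l : {ffun 'I_k -> 'I_(2 * n)}) (t : 'I_k) : int :=
  (l t)%:Z - n%:Z.

(** The centered box of side 2 * L is contained in the one of side 2 * n. *)
Lemma box_split (L n : nat) : (L <= n)%N ->
  exists S : {set {ffun 'I_k -> 'I_(2 * n)}},
    forall (V : zmodType) (H : ('I_k -> int) -> V),
    \sum_(l : {ffun 'I_k -> 'I_(2 * n)}) H (centered l) =
    \sum_(l : {ffun 'I_k -> 'I_(2 * L)}) H (centered l) +
    \sum_(l in S) H (centered l).
Proof.
move=> Ln; have lt (i : 'I_(2 * L)) : (i + (n - L) < 2 * n)%N.
  by have /= := ltn_ord i; lia.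
pose f (l : {ffun 'I_k -> 'I_(2 * L)}) : {ffun 'I_k -> 'I_(2 * n)} :=
  [ffun t => Ordinal (lt (l t))].
have finj : injective f.
  move=> l1 l2 /ffunP e; apply/ffunP => t; apply: val_inj.
  by have /(congr1 val) := e t; rewrite !ffunE /= => /addIn.
exists (~: (f @: [set: {ffun 'I_k -> 'I_(2 * L)}])) => V H.
rewrite (bigID (mem (f @: [set: {ffun 'I_k -> 'I_(2 * L)}]))) /=; congr (_ + _).
  rewrite big_imset /=; last by move=> ? ? _ _; exact: finj.
  apply: eq_big => [l|l _]; first by rewrite inE.
  by congr H; apply/funext => t; rewrite /centered ffunE /=; lia.
by apply: eq_bigl => l; rewrite !inE.
Qed.

(** The dominating sums over centered boxes increase to a finite supremum, so the
    terms outside a fixed large box contribute little, uniformly in n, and inside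
    that box there are finitely many convergent terms. *)
Lemma tannery (g : nat -> ('I_k -> int) -> R[i]) (delta : 'I_k -> int -> R) (C : R) :
  (forall t j, 0 <= delta t j) ->
  (forall t, exists K, forall n, \sum_(j < 2 * n) delta t (j%:Z - n%:Z) <= K) ->
  (forall n l, normc (g n l) <= C * \prod_t delta t (l t)) ->
  (forall l, cconverges (fun n => g n l)) ->
  cconverges (fun n => \sum_(l : {ffun 'I_k -> 'I_(2 * n)}) g n (centered l)).
Proof.
move=> d0 /choice[K dK] gC gcvg.
pose P n := \sum_(l : {ffun 'I_k -> 'I_(2 * n)}) \prod_t delta t (centered l t).
have prod0 l : 0 <= \prod_t delta t (l t) by apply: prodr_ge0 => t _.
have Pbnd n : P n <= \prod_t K t.
  rewrite /P /centered.
  rewrite -(bigA_distr_bigA (fun t (j : 'I_(2 * n)) => delta t (j%:Z - n%:Z))) /=.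
  by apply: ler_prod => t _; rewrite dK andbT sumr_ge0.
(* A positive constant is needed to divide the error by it. *)
have [e1 e1P] : exists C' : R, 0 < C' /\ C <= C'.
  by exists (`|C| + 1); rewrite ltr_wpDl// (le_trans (ler_norm _))// lerDl.
case: e1P => C'0 CC'.
have gC' n l : normc (g n l) <= e1 * \prod_t delta t (l t).
  by rewrite (le_trans (gC n l))// ler_wpM2r.
have Psup : has_sup (range P).
  by split; [exists (P 0%N), 0%N|exists (\prod_t K t) => _ [n _ <-]].
apply: cconverges_approx => e e0.
have ee : 0 < e / e1 by rewrite divr_gt0.
have [_ [L _ <-] PL] := sup_adherent ee Psup.
exists (fun n => \sum_(l : {ffun 'I_k -> 'I_(2 * L)}) g n (centered l)).
  by apply: cconverges_sum => l _; exact: gcvg.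
exists L => n Ln.
have [S HS] := box_split Ln.
rewrite HS addrC addKr (le_trans (ler_normc_sum _ _ _))//.
rewrite (le_trans (ler_sum _ (fun l _ => gC' n (centered l))))// -mulr_sumr.
rewrite mulrC -ler_pdivlMr//.
have -> : \sum_(l in S) \prod_t delta t (centered l t) = P n - P L.
  by rewrite /P (HS _ (fun l => \prod_t delta t (l t))) addrC addKr.
have Pn : P n <= sup (range P) by apply: ub_le_sup; [case: Psup|exists n].
by rewrite lerBlDr -lerBlDl; move: PL Pn; lra.
Qed.

End Tannery.

(** * Traces as sums over closed paths *)

Section Paths.
Local Open Scope set_scope.

Lemma mulmx_paths (A : pzRingType) (n k : nat) (M : 'I_k -> 'M[A]_n) (i j : 'I_n) :
  (\prod_(l < k) M l) i j =
  \sum_(v : {ffun 'I_k.+1 -> 'I_n} | (v ord0 == i) && (v ord_max == j))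
     \prod_(l < k) M l (v (widen_ord (leqnSn k) l)) (v (lift ord0 l)).
Proof.
elim: k M i => [|k IH] M i.
  rewrite big_ord0 mxE.
  have e0 (v : {ffun 'I_1 -> 'I_n}) : v ord_max = v ord0.
    by congr (v _); apply: val_inj.
  under eq_bigl do rewrite e0.
  under eq_bigr do rewrite big_ord0.
  have [->|ij] := eqVneq i j.
    rewrite (big_pred1 [ffun=> j]) // => v.
    rewrite andbb; apply/eqP/eqP => [vj|->]; last by rewrite ffunE.
    by apply/ffunP => x; rewrite ffunE ord1.
  rewrite big_pred0// => v; apply/negbTE; rewrite negb_and -negb_and.
  by apply/negP => /andP[/eqP -> /eqP]; apply/eqP.
rewrite big_ord_recl mxE.
under eq_bigr do rewrite IH big_distrr /=.
rewrite (exchange_big_dep (fun v : {ffun 'I_k.+1 -> 'I_n} => v ord_max == j)) /=;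
  last by move=> m v _ /andP[].
under eq_bigr => v vj.
  rewrite (big_pred1 (v ord0)); last first.
    by move=> m; rewrite /= vj andbT eq_sym.
  over.
pose f (v : {ffun 'I_k.+1 -> 'I_n}) : {ffun 'I_k.+2 -> 'I_n} :=
  [ffun t => if unlift ord0 t is Some s then v s else i].
pose g (w : {ffun 'I_k.+2 -> 'I_n}) : {ffun 'I_k.+1 -> 'I_n} :=
  [ffun s => w (lift ord0 s)].
have f0 v : f v ord0 = i by rewrite ffunE unlift_none.
have fS v s : f v (lift ord0 s) = v s by rewrite ffunE liftK.
rewrite (reindex_onto f g) /=; last first.
  move=> w /andP[/eqP w0 _]; apply/ffunP => t; rewrite ffunE.
  by case: unliftP => [s ->|->]; rewrite ?ffunE.
have max_lift : ord_max = lift ord0 ord_max :> 'I_k.+2 by apply: val_inj.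
apply: eq_big => [v|v vj].
  rewrite f0 eqxx max_lift fS; case: eqP => //= _.
  by apply/esym/eqP/ffunP => s; rewrite ffunE fS.
rewrite big_ord_recl.
have -> : widen_ord (leqnSn k.+1) ord0 = ord0 by apply: val_inj.
rewrite f0 fS; congr (_ * _); apply: eq_bigr => l _.
have -> : widen_ord (leqnSn k.+1) (lift ord0 l) = lift ord0 (widen_ord (leqnSn k) l).
  by apply: val_inj.
by rewrite !fS.
Qed.

Lemma mxtrace_paths (A : pzRingType) (n k : nat) (M : 'I_k -> 'M[A]_n) :
  \tr (\prod_(l < k) M l) =
  \sum_(v : {ffun 'I_k.+1 -> 'I_n} | v ord0 == v ord_max)
     \prod_(l < k) M l (v (widen_ord (leqnSn k) l)) (v (lift ord0 l)).
Proof.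
rewrite /mxtrace; under eq_bigr do rewrite mulmx_paths.
rewrite (exchange_big_dep (fun v : {ffun 'I_k.+1 -> 'I_n} => v ord0 == v ord_max)) /=;
  last by move=> i v _ /andP[/eqP -> /eqP ->].
apply: eq_bigr => v /eqP v0; rewrite (big_pred1 (v ord0))// => i /=.
by rewrite -v0 andbb eq_sym.
Qed.

Variables (k : nat) (rho st : 'I_k -> bool).

Definition sgnd (b : bool) (j : int) : int := if b then j else - j.

Lemma sgndK b : involutive (sgnd b).
Proof. by case: b => j //=; rewrite opprK. Qed.

Definition mirror n (b : bool) (a : int) : int := if b then n%:Z - 1 - a else a.

(** The displacement of a letter between the vertices a and b: the index at which
    the input sequence is read, for a letter T or D (st marks adjoints), and, for
    a letter P, the defect from being the mirror image. *)
Definition disp n (t : 'I_k) (a b : int) : int := sgnd (st t) (b - mirror n (rho t) a).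

(** The vertices of a path recovered from its start and its displacements. *)
Fixpoint pos n (v0 : int) (J : 'I_k -> int) (t : nat) : int :=
  if t is s.+1 then
    if insub s is Some o then mirror n (rho o) (pos n v0 J s) + sgnd (st o) (J o)
    else pos n v0 J s
  else v0.

Lemma posS n v0 J (t : 'I_k) :
  pos n v0 J t.+1 = mirror n (rho t) (pos n v0 J t) + sgnd (st t) (J t).
Proof. by rewrite /= valK. Qed.

Definition valid_path n v0 J : bool :=
  [forall t : 'I_k.+1, (0 <= pos n v0 J t < n%:Z)] && (pos n v0 J k == v0).

Definition path_disp n (v : {ffun 'I_k.+1 -> 'I_n}) (t : 'I_k) : int :=
  disp n t (v (widen_ord (leqnSn k) t))%:Z (v (lift ord0 t))%:Z.

Lemma pos_path n (v : {ffun 'I_k.+1 -> 'I_n}) (t : 'I_k.+1) :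
  pos n (v ord0)%:Z (path_disp v) t = (v t)%:Z.
Proof.
case: t => t; elim: t => [|t IH] tk.
  by rewrite /=; congr ((v _)%:Z); apply: val_inj.
have tk' : (t < k)%N by [].
rewrite -[LHS]/(pos n (v ord0)%:Z (path_disp v) (Ordinal tk').+1) posS.
rewrite [pos _ _ _ (Ordinal tk')]IH 1?ltnW//.
move=> tk1; rewrite /path_disp /disp sgndK.
have -> : widen_ord (leqnSn k) (Ordinal tk') = Ordinal tk1 by apply: val_inj.
have -> : lift ord0 (Ordinal tk') = Ordinal tk by apply: val_inj.
by rewrite addrC subrK.
Qed.

(** A closed path is the same thing as a start and displacements that keep the
    vertices in range and lead back to the start. The start is allowed to range over
    the larger interval [0, 2n) only to have the same box in every coordinate. *)
Lemma sum_paths (V : zmodType) (n : nat) (H : int -> ('I_k -> int) -> V) :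
  (0 < n)%N ->
  \sum_(v : {ffun 'I_k.+1 -> 'I_n} | v ord0 == v ord_max)
     H (v ord0)%:Z (path_disp v) =
  \sum_(v0 < 2 * n) \sum_(J : {ffun 'I_k -> 'I_(2 * n)})
     if valid_path n v0%:Z (centered J) then H v0%:Z (centered J) else 0.
Proof.
move=> n0; rewrite pair_big /= -big_mkcond /=.
have lt0 (i : 'I_n) : (i < 2 * n)%N by have /= := ltn_ord i; lia.
have ltJ (v : {ffun 'I_k.+1 -> 'I_n}) t : (`|(path_disp v t + n%:Z)%R| < 2 * n)%N.
  rewrite /path_disp /disp /mirror /sgnd.
  have /= := ltn_ord (v (widen_ord (leqnSn k) t)).
  have /= := ltn_ord (v (lift ord0 t)).
  by case: (rho t); case: (st t); lia.
have geJ (v : {ffun 'I_k.+1 -> 'I_n}) t : 0 <= path_disp v t + n%:Z.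
  rewrite /path_disp /disp /mirror /sgnd.
  have /= := ltn_ord (v (widen_ord (leqnSn k) t)).
  have /= := ltn_ord (v (lift ord0 t)).
  by case: (rho t); case: (st t); lia.
pose h (v : {ffun 'I_k.+1 -> 'I_n}) : 'I_(2 * n) * {ffun 'I_k -> 'I_(2 * n)} :=
  (Ordinal (lt0 (v ord0)), [ffun t => Ordinal (ltJ v t)]).
(* The remainder is a total substitute for the position, equal to it on valid
   paths. *)
pose h' (z : 'I_(2 * n) * {ffun 'I_k -> 'I_(2 * n)}) : {ffun 'I_k.+1 -> 'I_n} :=
  [ffun t : 'I_k.+1 => Ordinal (ltn_pmod `|pos n z.1%:Z (centered z.2) t| n0)].
have hJ v : centered (h v).2 = path_disp v.
  by apply/funext => t; rewrite /centered ffunE /= gez0_abs// addrK.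
have h'E (z : 'I_(2 * n) * {ffun 'I_k -> 'I_(2 * n)}) t : valid_path n z.1%:Z (centered z.2) ->
    (h' z t)%:Z = pos n z.1%:Z (centered z.2) t.
  move=> /andP[/forallP/(_ t)/andP[p0 pn] _]; rewrite ffunE /=.
  rewrite modn_small ?gez0_abs//; move: p0 pn; move: (pos _ _ _ _); lia.
rewrite [RHS](reindex_onto h h') /=; last first.
  move=> [v0 J] /= val; congr pair.
    by apply: val_inj; apply/eqP; rewrite -eqz_nat /= h'E.
  apply/ffunP => t; rewrite ffunE; apply: val_inj; apply/eqP; rewrite -eqz_nat /=.
  have E1 : (h' (v0, J) (lift ord0 t))%:Z = pos n v0%:Z (centered J) t.+1.
    exact: h'E.
  have E0 : (h' (v0, J) (widen_ord (leqnSn k) t))%:Z = pos n v0%:Z (centered J) t.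
    exact: h'E.
  rewrite gez0_abs// /path_disp E1 E0 posS /disp.
  by rewrite [mirror _ _ _ + _]addrC addrK sgndK /centered subrK.
apply: eq_big => [v|v _]; last by rewrite hJ.
rewrite hJ; have -> : h' (h v) == v.
  apply/eqP/ffunP => t; apply: val_inj; apply/eqP; rewrite ffunE /= -eqz_nat.
  by rewrite hJ pos_path /= modn_small.
rewrite andbT /valid_path.
have -> : [forall t : 'I_k.+1, 0 <= pos n (v ord0)%:Z (path_disp v) t < n%:Z].
  by apply/forallP => t; rewrite pos_path /= ltz_nat ltn_ord.
have := pos_path v ord_max; rewrite /= => ->.
by rewrite eqz_nat eq_sym.
Qed.

End Paths.

(** * Variables with finite moments *)

Section Moments.
Context (d : measure_display) (T : measurableType d) (R : realType).
Variable P : probability T R.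
Implicit Types (f g : T -> R) (Z W : T -> R[i]).
Local Notation normc := (@Normc.normc R).
Local Notation E f := (Rintegral P [set: T] f).

(** This class is closed under products, so no integrability has to be checked for
    the products of entries met later on. *)
Definition finite_moments f := measurable_fun [set: T] f /\
  forall k, P.-integrable [set: T] (fun w => (`|f w| ^+ k)%:E).

Lemma eq_finite_moments f g : (forall w, f w = g w) -> finite_moments f -> finite_moments g.
Proof. by move=> /funext ->. Qed.

Lemma finite_moments_le f (B : nat -> T -> R) : measurable_fun [set: T] f ->
  (forall k, P.-integrable [set: T] (fun w => (B k w)%:E)) ->
  (forall k w, `|f w| ^+ k <= B k w) -> finite_moments f.
Proof.
move=> mf iB fB; split=> // k; apply: le_integrable (iB k) => //.
  apply/measurable_EFinP/measurable_funX; exact: measurableT_comp.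
move=> w _; rewrite lee_fin ger0_norm ?exprn_ge0//.
by rewrite (le_trans (fB k w))// ler_norm.
Qed.

Lemma finite_moments_integrable f : finite_moments f -> P.-integrable [set: T] (EFin \o f).
Proof.
move=> [mf /(_ 1%N)]; apply: le_integrable => //; first exact/measurable_EFinP.
by move=> w _; rewrite /= expr1 normr_id.
Qed.

Lemma finite_moments_bounded f (C : R) : measurable_fun [set: T] f ->
  (forall w, `|f w| <= C) -> finite_moments f.
Proof.
move=> mf fC; apply: (@finite_moments_le _ (fun k => cst (C ^+ k))) => // [k|k w].
  exact: finite_measure_integrable_cst.
by rewrite lerXn2r ?nnegrE// (le_trans _ (fC w)).
Qed.

Lemma finite_moments_cst (c : R) : finite_moments (cst c).
Proof. exact: (@finite_moments_bounded _ `|c|). Qed.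

Lemma finite_moments_indic (A : set T) : measurable A -> finite_moments (\1_A : T -> R).
Proof.
move=> mA; apply: (@finite_moments_bounded _ 1) => // w.
by rewrite indicE; case: (_ \in _); rewrite ?normr1 ?normr0.
Qed.

Lemma finite_momentsM f g : finite_moments f -> finite_moments g ->
  finite_moments (fun w => f w * g w).
Proof.
move=> [mf If] [mg Ig].
apply: (@finite_moments_le _ (fun k w => `|f w| ^+ (k + k) + `|g w| ^+ (k + k))).
- exact: measurable_funM.
- by move=> k; exact: (integrableD _ (If _) (Ig _)).
- move=> k w; rewrite normrM exprMn !exprD.
  by have := sqr_ge0 (`|f w| ^+ k - `|g w| ^+ k); rewrite expr2; nra.
Qed.

Lemma ler_exprD (a b : R) k : 0 <= a -> 0 <= b ->
  (a + b) ^+ k <= 2 ^+ k * (a ^+ k + b ^+ k).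
Proof.
move=> a0 b0; wlog ab : a b a0 b0 / a <= b.
  by move=> H; case: (leP a b) => [|/ltW] /H; [exact|rewrite addrC [a ^+ _ + _]addrC; exact].
rewrite (@le_trans _ _ ((2 * b) ^+ k))//.
  by rewrite lerXn2r ?nnegrE ?addr_ge0 ?mulr_ge0//; lra.
by rewrite exprMn ler_wpM2l ?exprn_ge0// lerDr exprn_ge0.
Qed.

Lemma finite_momentsD f g : finite_moments f -> finite_moments g ->
  finite_moments (fun w => f w + g w).
Proof.
move=> [mf If] [mg Ig].
apply: (@finite_moments_le _ (fun k w => 2 ^+ k * (`|f w| ^+ k + `|g w| ^+ k))).
- exact: measurable_funD.
- by move=> k; exact: (integrableZl _ (2 ^+ k) (integrableD _ (If k) (Ig k))).
- move=> k w; apply: le_trans (ler_exprD k (normr_ge0 _) (normr_ge0 _)).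
  by rewrite lerXn2r ?nnegrE ?addr_ge0// ler_normD.
Qed.

Lemma finite_momentsN f : finite_moments f -> finite_moments (fun w => - f w).
Proof.
move=> hf; have := finite_momentsM (finite_moments_cst (-1)) hf.
by under eq_fun do rewrite mulN1r.
Qed.

Definition finite_cmoments Z := finite_moments (fun w => complex.Re (Z w)) /\
  finite_moments (fun w => complex.Im (Z w)).

Lemma finite_cmoments_cst (c : R[i]) : finite_cmoments (fun=> c).
Proof. by split; exact: finite_moments_cst. Qed.

Lemma finite_cmomentsD Z W : finite_cmoments Z -> finite_cmoments W ->
  finite_cmoments (fun w => Z w + W w).
Proof.
move=> [Z1 Z2] [W1 W2]; split.
  by apply: eq_finite_moments (finite_momentsD Z1 W1) => w; case: (Z w) (W w) => ? ? [? ?].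
by apply: eq_finite_moments (finite_momentsD Z2 W2) => w; case: (Z w) (W w) => ? ? [? ?].
Qed.

Lemma finite_cmomentsM Z W : finite_cmoments Z -> finite_cmoments W ->
  finite_cmoments (fun w => Z w * W w).
Proof.
move=> [Z1 Z2] [W1 W2]; split.
  apply: eq_finite_moments
    (finite_momentsD (finite_momentsM Z1 W1) (finite_momentsN (finite_momentsM Z2 W2))) => w.
  by case: (Z w) (W w) => ? ? [? ?].
apply: eq_finite_moments (finite_momentsD (finite_momentsM Z1 W2) (finite_momentsM Z2 W1)) => w.
by case: (Z w) (W w) => ? ? [? ?].
Qed.

Lemma finite_cmoments_conj Z : finite_cmoments Z -> finite_cmoments (fun w => (Z w)^*).
Proof.
move=> [Z1 Z2]; split.
  by apply: eq_finite_moments Z1 => w; case: (Z w).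
by apply: eq_finite_moments (finite_momentsN Z2) => w; case: (Z w).
Qed.

Lemma finite_cmoments_sum (I : Type) (r : seq I) (Q : pred I) (F : I -> T -> R[i]) :
  (forall i, Q i -> finite_cmoments (F i)) ->
  finite_cmoments (fun w => \sum_(i <- r | Q i) F i w).
Proof.
move=> FQ; elim: r => [|i r IH].
  by under eq_fun do rewrite big_nil; exact: finite_cmoments_cst.
under eq_fun do rewrite big_cons.
by case/boolP: (Q i) => // Qi; apply: finite_cmomentsD => //; exact: FQ.
Qed.

Lemma finite_cmoments_prod (I : Type) (r : seq I) (Q : pred I) (F : I -> T -> R[i]) :
  (forall i, Q i -> finite_cmoments (F i)) ->
  finite_cmoments (fun w => \prod_(i <- r | Q i) F i w).
Proof.
move=> FQ; elim: r => [|i r IH].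
  by under eq_fun do rewrite big_nil; exact: finite_cmoments_cst.
under eq_fun do rewrite big_cons.
by case/boolP: (Q i) => // Qi; apply: finite_cmomentsM => //; exact: FQ.
Qed.

Lemma cexpectationE Z : cexpectation P Z =
  E (fun w => complex.Re (Z w)) +i* E (fun w => complex.Im (Z w)).
Proof. by rewrite /cexpectation unlock. Qed.

Lemma eq_cexpectation Z W : (forall w, Z w = W w) ->
  cexpectation P Z = cexpectation P W.
Proof. by move=> ZW; congr cexpectation; apply/funext. Qed.

Lemma cexpectationD Z W : finite_cmoments Z -> finite_cmoments W ->
  cexpectation P (fun w => Z w + W w) = cexpectation P Z + cexpectation P W.
Proof.
move=> [Z1 Z2] [W1 W2]; rewrite !cexpectationE /=.
apply/eqP; rewrite eq_complex /= -!RintegralD//; try exact: finite_moments_integrable.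
by apply/andP; split; apply/eqP; apply: eq_Rintegral => w _; case: (Z w) (W w) => ? ? [? ?].
Qed.

Lemma cexpectationZ (c : R[i]) Z : finite_cmoments Z ->
  cexpectation P (fun w => c * Z w) = c * cexpectation P Z.
Proof.
move=> [/finite_moments_integrable Z1 /finite_moments_integrable Z2]; rewrite !cexpectationE /=.
case: c => a b; apply/eqP; rewrite eq_complex /= -!RintegralZl// -RintegralB// -?RintegralD//;
  try solve [exact: (integrableZl measurableT _ Z1)|exact: (integrableZl measurableT _ Z2)].
by apply/andP; split; apply/eqP; apply: eq_Rintegral => w _; case: (Z w).
Qed.

Lemma cexpectation_cst (c : R[i]) : cexpectation P (fun=> c) = c.
Proof.
rewrite cexpectationE !Rintegral_cst//= probability_setT /= !mulr1.
by case: c.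
Qed.

Lemma cexpectation_sum (I : Type) (r : seq I) (Q : pred I) (F : I -> T -> R[i]) :
  (forall i, Q i -> finite_cmoments (F i)) ->
  cexpectation P (fun w => \sum_(i <- r | Q i) F i w) =
  \sum_(i <- r | Q i) cexpectation P (F i).
Proof.
move=> FQ; elim: r => [|i r IH].
  under eq_cexpectation do rewrite big_nil.
  by rewrite big_nil cexpectation_cst.
under eq_cexpectation do rewrite big_cons.
rewrite big_cons; case/boolP: (Q i) => // Qi.
by rewrite cexpectationD ?IH//; [exact: FQ|exact: finite_cmoments_sum].
Qed.

Lemma normc_cexpectation_le Z (B : T -> R) : finite_cmoments Z ->
  P.-integrable [set: T] (EFin \o B) -> (forall w, normc (Z w) <= B w) ->
  normc (cexpectation P Z) <= 2 * E B.
Proof.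
move=> [Z1 Z2] iB ZB; rewrite (le_trans (normc_le_ReIm _))// cexpectationE /=.
have bnd (f : R[i] -> R) : (forall z, `|f z| <= normc z) ->
    finite_moments (fun w => f (Z w)) -> `|E (fun w => f (Z w))| <= E B.
  move=> fn mf; rewrite (le_trans (le_normr_Rintegral _ (finite_moments_integrable mf)))//.
  apply: le_Rintegral => //.
    by have := integrable_abse (finite_moments_integrable mf).
  by move=> w _; rewrite (le_trans (fn _)).
rewrite mulrDl !mul1r lerD ?bnd//.
- exact: (@normc_ge_Re R).
- exact: (@normc_ge_Im R).
Qed.

End Moments.

(** * Expectations of products of independent variables *)

Section IndependentFactor.
Import HBNNSimple.
Context (d d' : measure_display) (T : measurableType d) (S : measurableType d').
Context (R : realType) (P : probability T R).
Local Notation E f := (Rintegral P [set: T] f).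
Variables (X : T -> S) (H : T -> R).
Hypothesis mX : measurable_fun [set: T] X.
Hypothesis HH : finite_moments P H.
Hypothesis XH : forall A : set S, measurable A ->
  E (fun w => \1_A (X w) * H w) = fine (P (X @^-1` A)) * E H.

Let preX (A : set S) : measurable A -> measurable (X @^-1` A).
Proof. by move=> mA; rewrite -[X @^-1` A]setTI; exact: mX. Qed.

Let indicX (A : set S) : measurable A -> finite_moments P (fun w => \1_A (X w) : R).
Proof.
move=> mA; apply: eq_finite_moments (finite_moments_indic P (preX mA)) => w.
by rewrite !indicE.
Qed.

Lemma expectation_indic_comp (A : set S) : measurable A ->
  E (fun w => \1_A (X w)) = fine (P (X @^-1` A)).
Proof.
move=> mA; rewrite /Rintegral; under eq_integral => w _.
  rewrite (_ : \1_A (X w) = \1_(X @^-1` A) w); last by rewrite !indicE.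
  over.
by rewrite integral_indic ?setIT//; exact: preX.
Qed.

Lemma Rintegral_dominated (f : nat -> T -> R) (l B : T -> R) :
  (forall n, measurable_fun [set: T] (f n)) -> measurable_fun [set: T] l ->
  P.-integrable [set: T] (EFin \o B) -> (forall n w, `|f n w| <= B w) ->
  (forall w, f ^~ w @ \oo --> l w) ->
  (fun n => E (f n)) @ \oo --> E l.
Proof.
move=> mf ml iB fB fl.
have mEf n : measurable_fun [set: T] (EFin \o f n) by exact/measurable_EFinP.
have mEl : measurable_fun [set: T] (EFin \o l) by exact/measurable_EFinP.
have fEl : {ae P, forall w, [set: T] w -> (fun n => (EFin \o f n) w) @ \oo --> (EFin \o l) w}.
  by apply: aeW => w _; apply: cvg_EFin; [exact: nearW|exact: fl].
have fEB : {ae P, forall w n, [set: T] w -> (`|(EFin \o f n) w| <= (EFin \o B) w)%E}.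
  by apply: aeW => w n _; rewrite lee_fin.
have [il _ cvgI] := dominated_convergence measurableT mEf mEl fEl iB fEB.
by apply: fine_cvg; rewrite fineK; [exact: cvgI|exact: integrable_fin_num].
Qed.

(** The factorization is assumed for indicators of events of X. It passes to simple
    functions by linearity and to g by dominated convergence, the bound being
    |g(X) H|. *)
Lemma indep_factor_ge0 (g : S -> R) : measurable_fun [set: S] g ->
  (forall s, 0 <= g s) -> finite_moments P (fun w => g (X w)) ->
  E (fun w => g (X w) * H w) = E (fun w => g (X w)) * E H.
Proof.
move=> mg g0 Ig.
have mEg : measurable_fun [set: S] (EFin \o g) by exact/measurable_EFinP.
pose h := nnsfun_approx measurableT mEg.
have h0 n s : 0 <= h n s by [].
have hcvg s : h ^~ s @ \oo --> g s.
  have /fine_cvg := cvg_nnsfun_approx (f := EFin \o g) measurableT mEg (x := s) (fun x _ => g0 x) I.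
  exact.
have hg n s : h n s <= g s.
  rewrite -(cvg_lim _ (hcvg s))//; apply: nondecreasing_cvgn_le; last first.
    by apply/cvg_ex; exists (g s); exact: hcvg.
  move=> p q pq; have := nd_nnsfun_approx measurableT mEg pq.
  by move=> /lefP/(_ s).
have mhX n : measurable_fun [set: T] (fun w => h n (X w)).
  exact: measurableT_comp.
have mgX : measurable_fun [set: T] (fun w => g (X w)) by exact: measurableT_comp.
have hE n : E (fun w => h n (X w) * H w) = E (fun w => h n (X w)) * E H.
  pose s : seq R := finmap.enum_fset (fset_set (range (h n))).
  have hs x : h n x = \sum_(i < size s) s`_i * \1_(h n @^-1` [set s`_i]) x.
    exact: fimfunEord.
  have mA i : measurable (h n @^-1` [set s`_i]) by exact: measurable_funPTI.
  pose F i w := s`_i * \1_(h n @^-1` [set s`_i]) (X w).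
  have FI i : finite_moments P (F i) by apply: finite_momentsM; [exact: finite_moments_cst|
    exact: indicX].
  have sumE (G : nat -> T -> R) m : (forall i, finite_moments P (G i)) ->
      E (fun w => \sum_(i < m) G i w) = \sum_(i < m) E (G i).
    move=> IG; elim: m => [|m IH].
      under eq_Rintegral do rewrite big_ord0.
      by rewrite big_ord0 Rintegral_cst// mul0r.
    under eq_Rintegral do rewrite big_ord_recr /=.
    rewrite big_ord_recr /= -IH RintegralD//; last exact: finite_moments_integrable.
    apply: finite_moments_integrable; elim: m {IH} => [|m IHm].
      by apply: eq_finite_moments (finite_moments_cst P 0) => w; rewrite big_ord0.
    by apply: eq_finite_moments (finite_momentsD IHm (IG m)) => w; rewrite big_ord_recr.
  under [in LHS]eq_Rintegral do rewrite hs mulr_suml.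
  under [in RHS]eq_Rintegral do rewrite hs.
  rewrite (sumE F) // (sumE (fun i w => F i w * H w)); last first.
    by move=> i; exact: finite_momentsM.
  rewrite mulr_suml; apply: eq_bigr => i _; rewrite /F.
  under eq_Rintegral do rewrite -mulrA.
  rewrite RintegralZl ?XH//; last first.
    by apply: finite_moments_integrable; apply: finite_momentsM => //; exact: indicX.
  rewrite RintegralZl ?expectation_indic_comp ?mulrA//.
  by apply: finite_moments_integrable; exact: indicX.
have c1 : (fun n => E (fun w => h n (X w) * H w)) @ \oo --> E (fun w => g (X w) * H w).
  apply: (@Rintegral_dominated _ _ (fun w => `|g (X w) * H w|)).
  - by move=> n; apply: measurable_funM => //; case: HH.
  - by apply: measurable_funM => //; case: HH.
  - by have := integrable_abse (finite_moments_integrable (finite_momentsM Ig HH)).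
  - by move=> n w; rewrite !normrM ler_wpM2r// !ger0_norm.
  - by move=> w; apply: cvgMr_tmp; exact: hcvg.
have c2 : (fun n => E (fun w => h n (X w)) * E H) @ \oo --> E (fun w => g (X w)) * E H.
  apply: cvgMr_tmp; apply: (@Rintegral_dominated _ _ (fun w => g (X w))) => //.
  - exact: finite_moments_integrable.
  - by move=> n w; rewrite ger0_norm.
have {}c2 : (fun n => E (fun w => h n (X w) * H w)) @ \oo --> E (fun w => g (X w)) * E H.
  by under eq_fun do rewrite hE.
exact: (cvg_unique _ c1 c2).
Qed.

Lemma indep_factor (g : S -> R) : measurable_fun [set: S] g ->
  finite_moments P (fun w => g (X w)) ->
  E (fun w => g (X w) * H w) = E (fun w => g (X w)) * E H.
Proof.
move=> mg Ig.
have part (f : S -> R) : measurable_fun [set: S] f -> (forall s, `|f s| = `|g s|) ->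
    finite_moments P (fun w => Num.max (f (X w)) 0) /\
    E (fun w => Num.max (f (X w)) 0 * H w) = E (fun w => Num.max (f (X w)) 0) * E H.
  move=> mf fg.
  have mm : measurable_fun [set: S] (fun s => Num.max (f s) 0) by exact: measurable_maxr.
  suff I0 : finite_moments P (fun w => Num.max (f (X w)) 0).
    by split=> //; apply: (indep_factor_ge0 mm) => // s; rewrite le_max lexx orbT.
  apply: (@finite_moments_le _ _ _ _ _ (fun k w => `|g (X w)| ^+ k)).
  - exact: (measurableT_comp mm).
  - by case: Ig.
  - move=> k w; rewrite -fg lerXn2r ?nnegrE//.
    by rewrite /Num.max; case: ifP; rewrite ?normr0.
have [I1 E1] := part g mg (fun=> erefl).
have [I2 E2] := part (fun s => - g s) (measurable_funN mg) (fun s => normrN _).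
have gE s : g s = Num.max (g s) 0 - Num.max (- g s) 0.
  rewrite /Num.max oppr_lt0.
  by case: (ltrgt0P (g s)) => [_|_|->]; rewrite ?subr0 ?sub0r ?opprK ?oppr0.
under [in LHS]eq_Rintegral do rewrite gE mulrBl.
under [in RHS]eq_Rintegral do rewrite gE.
rewrite !RintegralB// ?mulrBl ?E1 ?E2//;
  by [exact/finite_moments_integrable/finite_momentsM|exact: finite_moments_integrable].
Qed.

End IndependentFactor.

Section IndependentProducts.
Context (d d' : measure_display) (T : measurableType d) (S : measurableType d').
Context (R : realType) (P : probability T R).
Local Notation cE := (cexpectation P).

Definition cmeasurable (g : S -> R[i]) :=
  measurable_fun [set: S] (fun s => complex.Re (g s)) /\
  measurable_fun [set: S] (fun s => complex.Im (g s)).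

Lemma measurable_funT_ext (f g : S -> R) : (forall s, f s = g s) ->
  measurable_fun [set: S] f -> measurable_fun [set: S] g.
Proof. by move=> /funext ->. Qed.

Lemma cmeasurableM g h : cmeasurable g -> cmeasurable h ->
  cmeasurable (fun s => g s * h s).
Proof.
move=> [g1 g2] [h1 h2]; split.
  have := measurable_funB (measurable_funM g1 h1) (measurable_funM g2 h2).
  by apply: measurable_funT_ext => s /=; case: (g s) (h s) => ? ? [? ?].
have := measurable_funD (measurable_funM g1 h2) (measurable_funM g2 h1).
by apply: measurable_funT_ext => s /=; case: (g s) (h s) => ? ? [? ?].
Qed.

Lemma cmeasurable_prod (I : Type) (r : seq I) (Q : pred I) (F : I -> S -> R[i]) :
  (forall i, Q i -> cmeasurable (F i)) ->
  cmeasurable (fun s => \prod_(i <- r | Q i) F i s).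
Proof.
move=> FQ; elim: r => [|i r IH].
  by split; under eq_fun do rewrite big_nil; exact: measurable_cst.
have [Qi|Qi] := boolP (Q i); last by under eq_fun do rewrite big_cons (negPf Qi).
by under eq_fun do rewrite big_cons Qi; exact: cmeasurableM (FQ _ Qi) IH.
Qed.

Lemma cexpectation_factor (X : T -> S) (H : T -> R[i]) (g : S -> R[i]) :
  measurable_fun [set: T] X -> finite_cmoments P H ->
  (forall A : set S, measurable A ->
     cE (fun w => (\1_A (X w))%:C * H w) = (fine (P (X @^-1` A)))%:C * cE H) ->
  cmeasurable g -> finite_cmoments P (fun w => g (X w)) ->
  cE (fun w => g (X w) * H w) = cE (fun w => g (X w)) * cE H.
Proof.
move=> mX [H1 H2] XH [mg1 mg2] [g1 g2].
have XHr A : measurable A ->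
    Rintegral P setT (fun w => \1_A (X w) * complex.Re (H w)) =
    fine (P (X @^-1` A)) * Rintegral P setT (fun w => complex.Re (H w)).
  move=> mA; have := XH A mA; rewrite !cexpectationE => /eqP.
  rewrite eq_complex /= !mul0r subr0 => /andP[/eqP <- _].
  by apply: eq_Rintegral => w _; case: (H w) => a b /=; rewrite mul0r subr0.
have XHi A : measurable A ->
    Rintegral P setT (fun w => \1_A (X w) * complex.Im (H w)) =
    fine (P (X @^-1` A)) * Rintegral P setT (fun w => complex.Im (H w)).
  move=> mA; have := XH A mA; rewrite !cexpectationE => /eqP.
  rewrite eq_complex /= !mul0r addr0 => /andP[_ /eqP <-].
  by apply: eq_Rintegral => w _; case: (H w) => a b /=; rewrite mul0r addr0.
have e11 := indep_factor mX H1 XHr mg1 g1.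
have e12 := indep_factor mX H1 XHr mg2 g2.
have e21 := indep_factor mX H2 XHi mg1 g1.
have e22 := indep_factor mX H2 XHi mg2 g2.
rewrite !cexpectationE; apply/eqP; rewrite eq_complex /= -e11 -e12 -e21 -e22.
rewrite -RintegralB// -?RintegralD//; try exact/finite_moments_integrable/finite_momentsM.
apply/andP; split; apply/eqP; apply: eq_Rintegral => w _;
  by case: (g (X w)) (H w) => ? ? [? ?].
Qed.

Variables (I : eqType) (X : I -> T -> S).
Hypothesis mX : forall i, measurable_fun [set: T] (X i).
Hypothesis indX : mutually_independent P X.

Let preX i (A : set S) : measurable A -> measurable (X i @^-1` A).
Proof. by move=> mA; rewrite -[X i @^-1` A]setTI; exact: mX. Qed.

Let finite_cmoments_indic i (A : set S) : measurable A ->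
  finite_cmoments P (fun w => (\1_A (X i w))%:C).
Proof.
move=> mA; split; last exact: finite_moments_cst.
by apply: eq_finite_moments (finite_moments_indic P (preX i mA)) => w; rewrite !indicE.
Qed.

Lemma cexpectation_prod_indic (s : seq I) (A : I -> set S) : uniq s ->
  (forall i, measurable (A i)) ->
  cE (fun w => \prod_(i <- s) (\1_(A i) (X i w))%:C) =
  \prod_(i <- s) (fine (P (X i @^-1` A i)))%:C.
Proof.
move=> us mA.
have -> : (fun w => \prod_(i <- s) (\1_(A i) (X i w))%:C) =
    (fun w => (\1_(\bigcap_(i in [set` s]) (X i @^-1` A i)) w)%:C : R[i]).
  apply/funext => w; rewrite -(rmorph_prod (real_complex R)) /=; congr (_ %:C).
  rewrite indicE; case: (boolP (w \in _)) => /=.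
    move=> /set_mem wA; rewrite big_seq big1// => i si.
    by rewrite indicE mem_set//; exact: (wA i).
  move=> /negP wA; have [i si wAi] : exists2 i, i \in s & w \notin X i @^-1` A i.
    apply: contrapT => H; apply: wA; apply/mem_set => i si.
    by apply: contrapT => Hi; apply: H; exists i => //; apply/negP => /set_mem.
  rewrite (big_rem i)//= indicE.
  rewrite (_ : (X i w \in A i) = false) ?mul0r//.
  by apply/negbTE; apply: contra wAi => /set_mem ?; apply/mem_set.
rewrite cexpectationE /= Rintegral_cst// mul0r.
rewrite /Rintegral integral_indic ?setIT//; last first.
  by apply: fin_bigcap_measurable => [|i _]; [exact: finite_seq|exact: preX].
rewrite [X in fine X](indX us mA : _ = _).
rewrite -(rmorph_prod (real_complex R)) /=; congr (_ +i* _).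
elim: s {us} => [|i s IH]; first by rewrite !big_nil.
rewrite !big_cons fineM ?IH//; first exact: (fin_num_measure P _ (preX _ (mA _))).
elim/big_ind: _ => [//|x y xf yf|j _]; first exact: fin_numM.
exact: (fin_num_measure P _ (preX _ (mA _))).
Qed.

(** The variables are converted one at a time from indicators to general functions:
    moving i from s2 to s1 is cexpectation_factor, whose hypothesis on events is the
    induction hypothesis with i in s2. *)
Lemma cexpectation_prod_mixed (g : I -> S -> R[i]) (s1 s2 : seq I) (A : I -> set S) :
  (forall i, i \in s1 -> cmeasurable (g i)) ->
  (forall i, i \in s1 -> finite_cmoments P (fun w => g i (X i w))) ->
  uniq (s1 ++ s2) -> (forall i, measurable (A i)) ->
  cE (fun w => \prod_(i <- s1) g i (X i w) * \prod_(i <- s2) (\1_(A i) (X i w))%:C) =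
  \prod_(i <- s1) cE (fun w => g i (X i w)) *
  \prod_(i <- s2) (fine (P (X i @^-1` A i)))%:C.
Proof.
elim: s1 s2 A => [|i s1 IH] s2 A mg Ig us mA.
  rewrite big_nil mul1r -cexpectation_prod_indic//.
  by apply: eq_cexpectation => w; rewrite big_nil mul1r.
have mg1 j : j \in s1 -> cmeasurable (g j) by move=> js; apply: mg; rewrite inE js orbT.
have Ig1 j : j \in s1 -> finite_cmoments P (fun w => g j (X j w)).
  by move=> js; apply: Ig; rewrite inE js orbT.
have us1 : uniq (s1 ++ s2) by case/andP: us.
have us2 : uniq (s1 ++ [:: i] ++ s2) by rewrite uniq_catCA.
under eq_cexpectation do rewrite big_cons -mulrA.
rewrite big_cons -mulrA -(IH s2 A)//.
apply: (cexpectation_factor (X := X i)) => //; [| |exact: mg (mem_head _ _)|exact: Ig (mem_head _ _)].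
  apply: finite_cmomentsM; last by apply: finite_cmoments_prod => j _; exact: finite_cmoments_indic.
  elim: s1 Ig1 {IH mg Ig us mg1 us1 us2} => [|j s1 IHs] Ig1.
    by under eq_fun do rewrite big_nil; exact: finite_cmoments_cst.
  under eq_fun do rewrite big_cons; apply: finite_cmomentsM; first exact: Ig1 (mem_head _ _).
  by apply: IHs => l ls; apply: Ig1; rewrite inE ls orbT.
(* B is the event of X i put in front of the events of s2. *)
move=> B mB.
pose A' j := if j == i then B else A j.
have mA' j : measurable (A' j) by rewrite /A'; case: ifP.
have i2 j : j \in s2 -> A' j = A j.
  rewrite /A'; case: eqP => // ->; have := us2.
  by rewrite cat_uniq /= => /and3P[_ _ /andP[/negPf ->]].
have := IH (i :: s2) A' mg1 Ig1 us2 mA'.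
have -> : \prod_(j <- i :: s2) (fine (P (X j @^-1` A' j)))%:C =
    (fine (P (X i @^-1` B)))%:C * \prod_(j <- s2) (fine (P (X j @^-1` A j)))%:C :> R[i].
  rewrite big_cons /A' eqxx; congr (_ * _); rewrite big_seq [RHS]big_seq.
  by apply: eq_bigr => j /i2; rewrite /A' => ->.
rewrite mulrCA -IH// => <-; apply: eq_cexpectation => w.
rewrite big_cons {1}/A' eqxx mulrCA; congr (_ * (_ * _)).
by rewrite big_seq [RHS]big_seq; apply: eq_bigr => j /i2 ->.
Qed.

Lemma cexpectation_prod (g : I -> S -> R[i]) (s : seq I) :
  (forall i, i \in s -> cmeasurable (g i)) ->
  (forall i, i \in s -> finite_cmoments P (fun w => g i (X i w))) -> uniq s ->
  cE (fun w => \prod_(i <- s) g i (X i w)) = \prod_(i <- s) cE (fun w => g i (X i w)).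
Proof.
move=> mg Ig us.
have := @cexpectation_prod_mixed g s [::] (fun=> setT) mg Ig.
rewrite cats0 big_nil mulr1 => <-//.
by apply: eq_cexpectation => w; rewrite big_nil mulr1.
Qed.

(** Factors that are functions of the same variable are first multiplied together. *)
Lemma cexpectation_prod_group (K : finType) (kap : K -> I) (Q : pred K)
    (F : K -> S -> R[i]) :
  (forall t, Q t -> cmeasurable (F t)) ->
  (forall t, Q t -> finite_cmoments P (fun w => F t (X (kap t) w))) ->
  cE (fun w => \prod_(t | Q t) F t (X (kap t) w)) =
  \prod_(c <- undup [seq kap t | t <- enum Q])
     cE (fun w => \prod_(t | Q t && (kap t == c)) F t (X c w)).
Proof.
move=> mF IF; rewrite -(cexpectation_prod (g := fun c s => \prod_(t | Q t && (kap t == c)) F t s)).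
- apply: eq_cexpectation => w.
  rewrite [RHS](exchange_big_dep Q) /=; last by move=> c t _ /andP[].
  apply: eq_bigr => t Qt; under eq_bigl do rewrite Qt /= eq_sym.
  rewrite -big_filter filter_pred1_uniq ?undup_uniq ?big_seq1//.
  by rewrite mem_undup; apply/mapP; exists t; rewrite ?mem_enum.
- by move=> c _; apply: cmeasurable_prod => t /andP[Qt _]; exact: mF.
- by move=> c _; apply: finite_cmoments_prod => t /andP[Qt /eqP <-]; exact: IF.
- exact: undup_uniq.
Qed.

End IndependentProducts.

(** * Variables with the same law and the input variables *)

Section SameLaw.
Context (d d' : measure_display) (T : measurableType d) (S : measurableType d').
Context (R : realType) (P : probability T R).
Variables (X Y : T -> S).
Hypothesis (mX : measurable_fun [set: T] X) (mY : measurable_fun [set: T] Y).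
Hypothesis XY : same_law P X Y.

Lemma same_law_integral (g : S -> \bar R) : measurable_fun [set: S] g ->
  (forall s, 0 <= g s)%E -> (\int[P]_w g (X w) = \int[P]_w g (Y w))%E.
Proof.
move=> mg g0.
have := @ge0_integral_pushforward _ _ _ _ _ X mX P [set: S] g measurableT mg (fun s _ => g0 s).
have := @ge0_integral_pushforward _ _ _ _ _ Y mY P [set: S] g measurableT mg (fun s _ => g0 s).
rewrite !preimage_setT => <- <-.
by apply: eq_measure_integral => A mA _; exact: XY.
Qed.

End SameLaw.

Section SameLawExpectation.
Context (d d' : measure_display) (T : measurableType d) (S : measurableType d').
Context (R : realType) (P : probability T R).
Variables (X Y : T -> S).
Hypothesis (mX : measurable_fun [set: T] X) (mY : measurable_fun [set: T] Y).
Hypothesis XY : same_law P X Y.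

Lemma same_law_finite_moments (f : S -> R) : measurable_fun [set: S] f ->
  finite_moments P (fun w => f (Y w)) ->
  finite_moments P (fun w => f (X w)) /\
  Rintegral P setT (fun w => f (X w)) = Rintegral P setT (fun w => f (Y w)).
Proof.
move=> mf [mfY IY].
have mEf : measurable_fun [set: S] (EFin \o f) by exact/measurable_EFinP.
split.
  split=> [|k]; first exact: measurableT_comp.
  have mfk : measurable_fun [set: S] (fun s => (`|f s| ^+ k)%:E).
    by apply/measurable_EFinP/measurable_funX; exact: measurableT_comp.
  have fk0 s : (0 <= (`|f s| ^+ k)%:E)%E by rewrite lee_fin exprn_ge0.
  apply/integrableP; split; first exact: (measurableT_comp mfk).
  have /integrableP[_] := IY k.
  under eq_integral do rewrite gee0_abs//.
  under [in X in _ -> X]eq_integral do rewrite gee0_abs//.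
  by rewrite -(same_law_integral mX mY XY mfk fk0).
have posE (Z : T -> S) : ((fun w => (f (Z w))%:E)^\+ = (EFin \o f)^\+ \o Z)%E.
  exact: (funepos_comp (EFin \o f) Z).
have negE (Z : T -> S) : ((fun w => (f (Z w))%:E)^\- = (EFin \o f)^\- \o Z)%E.
  exact: (funeneg_comp (EFin \o f) Z).
rewrite /Rintegral integralE [in RHS]integralE !posE !negE; congr (fine (_ - _)%E).
  exact: (same_law_integral mX mY XY (measurable_funepos mEf) (fun s => funepos_ge0 _ s)).
exact: (same_law_integral mX mY XY (measurable_funeneg mEf) (fun s => funeneg_ge0 _ s)).
Qed.

(** Needed because a copy is only known to have the law of a Toeplitz matrix: its
    entries need not depend pointwise on the difference of the indices. *)
Lemma same_law_cexpectation (g : S -> R[i]) : cmeasurable g ->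
  finite_cmoments P (fun w => g (Y w)) ->
  finite_cmoments P (fun w => g (X w)) /\
  cexpectation P (fun w => g (X w)) = cexpectation P (fun w => g (Y w)).
Proof.
move=> [m1 m2] [I1 I2]; rewrite /finite_cmoments !cexpectationE.
have [A1 ->] := same_law_finite_moments m1 I1.
by have [A2 ->] := same_law_finite_moments m2 I2.
Qed.

End SameLawExpectation.

Section Inputs.
Context (d : measure_display) (T : measurableType d) (R : realType).
Variable P : probability T R.
Variables (x y x' y' : nat -> int -> {RV P >-> R}).
Variables (rho1 rho2 rho3 rho4 rho5 rho6 s s' : R).
Hypothesis hB : assumption_B x y x' y' rho1 rho2 rho3 rho4 rho5 rho6.
Hypothesis hs : constant_second_moments x x' s s'.
Local Notation normc := (@Normc.normc R).
Local Notation cE := (cexpectation P).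
Local Notation E f := (Rintegral P [set: T] f).

(** All that the j-th pair of inputs (a_j, b_j) carries; these vectors are
    independent over j. *)
Definition input_vec (n : nat) (j : int) (w : T) : (R * R) * (R * R) :=
  ((x n j w, y n j w), (x' n j w, y' n j w)).

Definition coord (b i : bool) (v : (R * R) * (R * R)) : R :=
  let z := if b then v.1 else v.2 in if i then z.1 else z.2.

(** The value read by a random letter: b chooses between a_j and b_j, e marks an
    adjoint. *)
Definition input (e b : bool) (v : (R * R) * (R * R)) : R[i] :=
  let z := coord b true v +i* coord b false v in if e then z^* else z.

Lemma measurable_coord b i : measurable_fun [set: (R * R) * (R * R)] (coord b i).
Proof.
case: b; case: i.
- exact: (measurableT_comp measurable_fst measurable_fst).
- exact: (measurableT_comp measurable_snd measurable_fst).
- exact: (measurableT_comp measurable_fst measurable_snd).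
- exact: (measurableT_comp measurable_snd measurable_snd).
Qed.

Lemma cmeasurable_input e b : cmeasurable (input e b).
Proof.
have h := measurable_coord b.
by case: e; split;
  [exact: h true|exact: measurable_funN (h false)|exact: h true|exact: h false].
Qed.

Lemma measurable_input_vec n j : measurable_fun [set: T] (input_vec n j).
Proof.
by apply: measurable_fun_pair; apply: measurable_fun_pair; exact: measurable_funPT.
Qed.

Lemma coord_moments k : (0 < k)%N -> exists c : R, forall n j b i,
  P.-integrable [set: T] (fun w => (`|coord b i (input_vec n j w)| ^+ k)%:E) /\
  E (fun w => `|coord b i (input_vec n j w)| ^+ k) <= c.
Proof.
move=> k0; have [c hc] := B_moments hB k0; exists c => n j b i.
have key (u : {RV P >-> R}) : ('E_P[fun w => (`|u w| ^+ k)%R] <= c%:E)%E ->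
    P.-integrable [set: T] (fun w => (`|u w| ^+ k)%:E) /\ E (fun w => `|u w| ^+ k) <= c.
  rewrite unlock => uc.
  have iu : P.-integrable [set: T] (fun w => (`|u w| ^+ k)%:E).
    apply/integrableP; split.
      by apply/measurable_EFinP/measurable_funX; apply: measurableT_comp.
    under eq_integral do rewrite gee0_abs ?lee_fin ?exprn_ge0//.
    by rewrite (le_lt_trans uc)// ltry.
  split=> //; rewrite -lee_fin; apply: le_trans uc.
  by rewrite fineK//; exact: integrable_fin_num.
by have [h1 h2 h3 h4] := hc n j; case: b; case: i; apply: key.
Qed.

Lemma finite_moments_coord n j b i : finite_moments P (fun w => coord b i (input_vec n j w)).
Proof.
split.
  exact: measurableT_comp (measurable_coord b i) (measurable_input_vec n j).
case=> [|k]; last by have [c /(_ n j b i)[]] := coord_moments (ltn0Sn k).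
under eq_fun do rewrite expr0; exact: finite_measure_integrable_cst.
Qed.

Lemma finite_cmoments_input n j e b : finite_cmoments P (fun w => input e b (input_vec n j w)).
Proof.
have hz : finite_cmoments P (fun w => coord b true (input_vec n j w) +i*
                              coord b false (input_vec n j w)).
  by split; exact: finite_moments_coord.
by rewrite /input; case: e => //; exact: finite_cmoments_conj.
Qed.

Lemma normc_input_le e b v : normc (input e b v) <=
  1 + (`|coord true true v| + `|coord true false v| +
       (`|coord false true v| + `|coord false false v|)).
Proof.
rewrite /input; set z := _ +i* _.
have -> : normc (if e then z^* else z) = normc z.
  by case: e => //; rewrite /z /= sqrrN.
rewrite (le_trans (normc_le_ReIm z))// /z /=.
by case: b {z}; have := normr_ge0 (coord true true v);
  have := normr_ge0 (coord true false v);
  have := normr_ge0 (coord false true v);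
  have := normr_ge0 (coord false false v); lra.
Qed.

(** In absolute value every factor is at most 1 + Z, with Z the sum of the moduli of
    the four real inputs, and the moments of Z are bounded uniformly in n and j. *)
Lemma block_bound (K : finType) : exists2 C : R, 0 <= C &
  forall n j (B : pred K) (e b : K -> bool),
  normc (cE (fun w => \prod_(t | B t) input (e t) (b t) (input_vec n j w))) <= C.
Proof.
(* The successor makes the exponent positive, as the moment bounds require. *)
set N := #|K|.+1.
have [c hc] := coord_moments (ltn0Sn #|K|); rewrite -/N in hc.
pose D : R := 2 * (2 ^+ N * (1 + 2 ^+ N * (2 ^+ N * (c + c) + 2 ^+ N * (c + c)))).
suff DP : forall n j (B : pred K) (e b : K -> bool),
    normc (cE (fun w => \prod_(t | B t) input (e t) (b t) (input_vec n j w))) <= D.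
  exists D => //; have := DP 0%N 0 pred0 (fun=> true) (fun=> true).
  exact: le_trans (normc_ge0 _).
move=> n j B e b.
pose A b i w := `|coord b i (input_vec n j w)|.
pose Z w := A true true w + A true false w + (A false true w + A false false w).
pose M w := 2 ^+ N * (1 + 2 ^+ N * (2 ^+ N * (A true true w ^+ N + A true false w ^+ N)
                                    + 2 ^+ N * (A false true w ^+ N + A false false w ^+ N))).
have A0 b1 i1 w : 0 <= A b1 i1 w by exact: normr_ge0.
have iA b1 i1 : P.-integrable [set: T] (EFin \o (fun w => A b1 i1 w ^+ N)).
  by case: (hc n j b1 i1).
have iAD b1 i1 b2 i2 : P.-integrable [set: T] (EFin \o (fun w => A b1 i1 w ^+ N + A b2 i2 w ^+ N)).
  exact: (integrableD _ (iA b1 i1) (iA b2 i2)).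
have iS b1 i1 b2 i2 : P.-integrable [set: T]
    (EFin \o (fun w => 2 ^+ N * (A b1 i1 w ^+ N + A b2 i2 w ^+ N))).
  exact: (integrableZl _ (2 ^+ N) (iAD _ _ _ _)).
have iSS : P.-integrable [set: T] (EFin \o (fun w =>
      2 ^+ N * (A true true w ^+ N + A true false w ^+ N)
    + 2 ^+ N * (A false true w ^+ N + A false false w ^+ N))).
  exact: (integrableD _ (iS _ _ _ _) (iS _ _ _ _)).
have iSSZ := integrableZl measurableT (2 ^+ N) iSS.
have i1 : P.-integrable [set: T] (EFin \o (fun=> 1 : R)).
  exact: finite_measure_integrable_cst.
have iM1 := integrableD measurableT i1 iSSZ.
have iM : P.-integrable [set: T] (EFin \o M) := integrableZl measurableT (2 ^+ N) iM1.
have prodM w : normc (\prod_(t | B t) input (e t) (b t) (input_vec n j w)) <= M w.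
  rewrite normc_prod; apply: (@le_trans _ _ ((1 + Z w) ^+ N)).
    apply: (@le_trans _ _ (\prod_(t | B t) (1 + Z w))).
      by apply: ler_prod => t _; rewrite normc_ge0 normc_input_le.
    rewrite prodr_const ler_weXn2l//; first by rewrite lerDl !addr_ge0.
    exact: leq_trans (max_card _) _.
  rewrite (le_trans (ler_exprD _ _ _)) ?addr_ge0// /M expr1n ler_wpM2l ?exprn_ge0//.
  rewrite lerD2l (le_trans (ler_exprD _ _ _)) ?addr_ge0// ler_wpM2l ?exprn_ge0//.
  by rewrite lerD// ler_exprD.
have cm : finite_cmoments P (fun w => \prod_(t | B t) input (e t) (b t) (input_vec n j w)).
  by apply: finite_cmoments_prod => t _; exact: finite_cmoments_input.
rewrite (le_trans (normc_cexpectation_le cm iM prodM))// ler_wpM2l//.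
rewrite RintegralZl// ler_wpM2l ?exprn_ge0//.
have E1 : E (fun=> 1 : R) = 1 by rewrite Rintegral_cst//= probability_setT mul1r.
rewrite RintegralD// E1 lerD2l.
rewrite RintegralZl// ler_wpM2l ?exprn_ge0// RintegralD// !RintegralZl// !RintegralD//.
by rewrite lerD// ler_wpM2l ?exprn_ge0// lerD//; exact: (hc n j _ _).2.
Qed.

Lemma cexpectation_input_eq0 n j e b : cE (fun w => input e b (input_vec n j w)) = 0.
Proof.
have h : cE (fun w => coord b true (input_vec n j w) +i* coord b false (input_vec n j w)) = 0.
  by case: b; [exact: (B_mean_a hB)|exact: (B_mean_b hB)].
case: e => //; rewrite /input; move: h; rewrite !cexpectationE /= => /eqP.
rewrite eq_complex /= => /andP[/eqP -> /eqP h2].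
have hm : E (fun w => - coord b false (input_vec n j w)) = 0.
  under eq_Rintegral do rewrite -mulN1r.
  rewrite RintegralZl//; last by apply: finite_moments_integrable; exact: finite_moments_coord.
  by rewrite h2 mulr0.
by rewrite hm.
Qed.

(** The ten products of two real inputs have prescribed expectations, except the
    squares of the imaginary parts, which are complements to the variance one. *)
Lemma second_moments n j b1 i1 b2 i2 :
  E (fun w => coord b1 i1 (input_vec n j w) * coord b2 i2 (input_vec n j w)) =
  E (fun w => coord b1 i1 (input_vec 0 0 w) * coord b2 i2 (input_vec 0 0 w)).
Proof.
have EE (f : T -> R) (c : R) : ('E_P[f] = c%:E)%E -> E f = c.
  by rewrite unlock => h; rewrite /Rintegral h.
have sq n' j' b : E (fun w => coord b true (input_vec n' j' w) ^+ 2) = if b then s else s'.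
  by have [h h'] := hs n' j'; case: b; exact: EE.
have tot n' j' b : E (fun w => coord b true (input_vec n' j' w) ^+ 2 +
                              coord b false (input_vec n' j' w) ^+ 2) = 1.
  apply: EE; case: b; [rewrite -(B_var_a hB n' j')|rewrite -(B_var_b hB n' j')];
    congr ('E_P[_])%E; apply/funext => w /=;
    by rewrite sqr_sqrtr// addr_ge0// sqr_ge0.
have isq n' j' b i : P.-integrable [set: T] (EFin \o (fun w => coord b i (input_vec n' j' w) ^+ 2)).
  apply/finite_moments_integrable; have hc := finite_moments_coord n' j' b i.
  apply: eq_finite_moments (finite_momentsM hc hc).
  by move=> w; rewrite expr2.
have sqy n' j' b : E (fun w => coord b false (input_vec n' j' w) ^+ 2) = 1 - if b then s else s'.
  by rewrite -(tot n' j' b) RintegralD// sq addrC addKr.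
have sqE n' j' b i : E (fun w => coord b i (input_vec n' j' w) * coord b i (input_vec n' j' w)) =
    E (fun w => coord b i (input_vec n' j' w) ^+ 2).
  by apply: eq_Rintegral => w _; rewrite expr2.
have comm n' j' b1' i1' b2' i2' :
   E (fun w => coord b1' i1' (input_vec n' j' w) * coord b2' i2' (input_vec n' j' w)) =
   E (fun w => coord b2' i2' (input_vec n' j' w) * coord b1' i1' (input_vec n' j' w)).
  by apply: eq_Rintegral => w _; rewrite mulrC.
suff [M HM] : exists M : R, forall n j,
    E (fun w => coord b1 i1 (input_vec n j w) * coord b2 i2 (input_vec n j w)) = M.
  by rewrite !HM.
have c1 n' j' := EE _ _ (B_rho1 hB n' j').
have c2 n' j' := EE _ _ (B_rho2 hB n' j').
have c3 n' j' := EE _ _ (B_rho3 hB n' j').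
have c4 n' j' := EE _ _ (B_rho4 hB n' j').
have c5 n' j' := EE _ _ (B_rho5 hB n' j').
have c6 n' j' := EE _ _ (B_rho6 hB n' j').
case: b1; case: i1; case: b2; case: i2;
  try (by eexists => n' j'; rewrite sqE ?sq ?sqy);
  first [by eexists => n' j'; exact: c1|by eexists => n' j'; exact: c2
        |by eexists => n' j'; exact: c3|by eexists => n' j'; exact: c4
        |by eexists => n' j'; exact: c5|by eexists => n' j'; exact: c6
        |by eexists => n' j'; rewrite comm; exact: c1|by eexists => n' j'; rewrite comm; exact: c2
        |by eexists => n' j'; rewrite comm; exact: c3|by eexists => n' j'; rewrite comm; exact: c4
        |by eexists => n' j'; rewrite comm; exact: c5|by eexists => n' j'; rewrite comm; exact: c6].
Qed.

(** This is where the constancy of the second moments enters: pair blocks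
    contribute factors that depend neither on n nor on the displacement. *)
Lemma cexpectation_pair n j e1 b1 e2 b2 :
  cE (fun w => input e1 b1 (input_vec n j w) * input e2 b2 (input_vec n j w)) =
  cE (fun w => input e1 b1 (input_vec 0 0 w) * input e2 b2 (input_vec 0 0 w)).
Proof.
pose sg (e : bool) : R := if e then -1 else 1.
have inE n' j' : cE (fun w => input e1 b1 (input_vec n' j' w) * input e2 b2 (input_vec n' j' w)) =
   (E (fun w => coord b1 true (input_vec n' j' w) * coord b2 true (input_vec n' j' w)) -
    (sg e1 * sg e2) * E (fun w => coord b1 false (input_vec n' j' w) * coord b2 false (input_vec n' j' w))) +i*
   (sg e2 * E (fun w => coord b1 true (input_vec n' j' w) * coord b2 false (input_vec n' j' w)) +
    sg e1 * E (fun w => coord b1 false (input_vec n' j' w) * coord b2 true (input_vec n' j' w))).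
  have ic b i b' i' : P.-integrable [set: T] (EFin \o
      (fun w => coord b i (input_vec n' j' w) * coord b' i' (input_vec n' j' w))).
    by apply/finite_moments_integrable/finite_momentsM; exact: finite_moments_coord.
  have icz (c : R) b i b' i' : P.-integrable [set: T] (EFin \o
      (fun w => c * (coord b i (input_vec n' j' w) * coord b' i' (input_vec n' j' w)))).
    exact: (integrableZl _ c (ic _ _ _ _)).
  rewrite cexpectationE -!RintegralZl// -RintegralB// -RintegralD//.
  by congr (_ +i* _); apply: eq_Rintegral => w _; rewrite /input /sg;
    case: e1; case: e2 => /=; ring.
by rewrite !inE !(second_moments n j).
Qed.

End Inputs.

(** * Blocks of random letters *)

Section Blocks.
Local Open Scope set_scope.
Variables (k : nat) (I : eqType) (rnd : 'I_k -> option I).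
Implicit Types (e : rel 'I_k) (J : 'I_k -> int) (t s : 'I_k).

(** Two random letters are correlated when they belong to the same copy and read the
    same index; a fixed letter is alone in its block. *)
Definition same_block e t s :=
  (t == s) || [&& isSome (rnd t), rnd t == rnd s & e t s].

(** The pattern of a displacement vector, encoded by a canonical representative of
    each block: pick depends only on the block as a set. *)
Definition block_of e : {ffun 'I_k -> 'I_k} :=
  [ffun t => odflt t [pick s | same_block e t s]].

Definition eq_disp J : rel 'I_k := fun t s => J t == J s.
Local Notation blk J := (block_of (eq_disp J)).

Lemma same_block_of J t : same_block (eq_disp J) t (blk J t).
Proof.
rewrite ffunE; case: pickP => //= /(_ t).
by rewrite /same_block eqxx.
Qed.

Lemma block_of_eq J t s : same_block (eq_disp J) t s -> blk J t = blk J s.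
Proof.
move=> ts; rewrite !ffunE.
have -> : [pick z | same_block (eq_disp J) t z] = [pick z | same_block (eq_disp J) s z].
  apply: eq_pick => z; move: ts; rewrite /same_block /eq_disp.
  case/orP => [/eqP ->//|/and3P[rt /eqP rts /eqP Jts]].
  rewrite -rts -Jts rt /=; case: (eqVneq t z) => [<-|_] /=.
    by rewrite !eqxx orbT.
  case: (eqVneq s z) => [<-|_] //=.
  by rewrite rts Jts !eqxx.
case: pickP => //= /(_ s); by rewrite /same_block eqxx.
Qed.

Lemma block_of_random J t : isSome (rnd t) ->
  [/\ rnd (blk J t) = rnd t, J (blk J t) = J t & blk J (blk J t) = blk J t].
Proof.
move=> rt; have h := same_block_of J t; split.
- by case/orP: h => [/eqP <-//|/and3P[_ /eqP]].
- by case/orP: h => [/eqP <-//|/and3P[_ _ /eqP]].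
- exact/esym/block_of_eq.
Qed.

Lemma block_of_eqE J t s : isSome (rnd t) -> rnd t = rnd s ->
  (blk J t == blk J s) = (J t == J s).
Proof.
move=> rt rts; apply/eqP/eqP => [bts|Jts].
  have [_ <- _] := block_of_random J rt; rewrite bts.
  by rewrite rts in rt; have [] := block_of_random J rt.
by apply: block_of_eq; rewrite /same_block rt rts /eq_disp Jts !eqxx orbT.
Qed.

Variable f : {ffun 'I_k -> 'I_k}.

Definition block_rep t := isSome (rnd t) && (f t == t).

(** Displacements with pattern f: the fixed letters take theirs from l, the random
    ones from the value of u at the representative of their block. *)
Definition mix_disp n (l : 'I_k -> int) (u : 'I_k -> nat) t : int :=
  if rnd t then (u (f t))%:Z - n%:Z else l t.

(** The displacements with pattern f are parametrized by l on the fixed letters and u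
    on the representatives. The other coordinates of u are summed over as well, which
    multiplies the sum by a power of 2 * n but keeps every sum over the same box; the
    unused coordinates of l are set to 0. *)
Lemma sum_mix_disp (V : zmodType) n (h : ('I_k -> int) -> V) : (0 < n)%N ->
  (\sum_(J : {ffun 'I_k -> 'I_(2 * n)} | blk (centered J) == f) h (centered J))
    *+ (2 * n) ^ (k - #|block_rep|) =
  \sum_(l : {ffun 'I_k -> 'I_(2 * n)} |
          [forall t, isSome (rnd t) ==> (centered l t == 0)])
    \sum_(u : {ffun 'I_k -> 'I_(2 * n)} |
            blk (mix_disp n (centered l) (fun t => u t)) == f)
       h (mix_disp n (centered l) (fun t => u t)).
Proof.
move=> n0.
pose E (l u : {ffun 'I_k -> 'I_(2 * n)}) : {ffun 'I_k -> 'I_(2 * n)} :=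
  [ffun t => if rnd t then u (f t) else l t].
have cE l u : centered (E l u) = mix_disp n (centered l) (fun t => u t).
  by apply/funext => t; rewrite /centered /mix_disp ffunE; case: (rnd t).
have lt0 : (n < 2 * n)%N by lia.
pose zero : 'I_(2 * n) := Ordinal lt0.
pose det (J : {ffun 'I_k -> 'I_(2 * n)}) : {ffun 'I_k -> 'I_(2 * n)} :=
  [ffun t => if rnd t then zero else J t].
(* Given l, the vectors u producing J are free outside the representatives and
   prescribed on them. *)
have fib l (J : {ffun 'I_k -> 'I_(2 * n)}) : blk (centered J) == f ->
    [forall t, isSome (rnd t) ==> (centered l t == 0)] ->
    #|[pred u | E l u == J]| = if l == det J then ((2 * n) ^ (k - #|block_rep|))%N else 0%N.
  move=> /eqP bJ /forallP l0.
  have Jf t : isSome (rnd t) -> [/\ isSome (rnd (f t)), J (f t) = J t & f (f t) = f t].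
    move=> rt; have [e1 e2 e3] := block_of_random (centered J) rt.
    rewrite -bJ; split=> //; first by rewrite e1.
    by apply: val_inj; apply/eqP; rewrite -eqz_nat; move: e2; rewrite /centered => /addIr ->.
  case: eqP => [lJ|lJ]; last first.
    apply: eq_card0 => u; rewrite inE; apply/negP => /eqP EJ; apply: lJ.
    apply/ffunP => t; rewrite ffunE -EJ ffunE; have := l0 t.
    case: (rnd t) => //= _ /eqP/eqP; rewrite /centered subr_eq0 eqz_nat => /eqP lt.
    exact: val_inj.
  pose F t : pred 'I_(2 * n) := if block_rep t then pred1 (J t) else predT.
  have -> : #|[pred u | E l u == J]| = #|family F|.
    apply: eq_card => u; rewrite !inE; apply/eqP/familyP => [EJ t|uF].
      rewrite /F; case: ifP => // /andP[rt /eqP ft]; rewrite inE -EJ ffunE ft.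
      by case: (rnd t) rt.
    apply/ffunP => t; rewrite ffunE lJ ffunE; have := Jf t.
    case: (rnd t) => // c /(_ isT)[r1 r2 r3]; have := uF (f t).
    by rewrite /F /block_rep r1 r3 eqxx /= inE => /eqP ->.
  rewrite card_family foldrE big_map big_enum /=.
  rewrite (bigID block_rep) /= big1 ?mul1n; last first.
    by move=> t rt; rewrite /F rt card1.
  under eq_bigr => t rt do rewrite /F (negPf rt) card_ord.
  rewrite prod_nat_const; congr (_ ^ _)%N.
  have := cardC block_rep; rewrite card_ord.
  have -> : #|[predC block_rep]| = #|(fun t => ~~ block_rep t)| by apply: eq_card.
  by move=> e; rewrite -(addKn #|block_rep| #|(fun t => ~~ block_rep t)|); congr (_ - _)%N.
have inner (l : {ffun 'I_k -> 'I_(2 * n)}) : [forall t, isSome (rnd t) ==> (centered l t == 0)] ->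
    \sum_(u : {ffun 'I_k -> 'I_(2 * n)} |
            blk (mix_disp n (centered l) (fun t => u t)) == f)
       h (mix_disp n (centered l) (fun t => u t)) =
    \sum_(J : {ffun 'I_k -> 'I_(2 * n)} | blk (centered J) == f)
      (if l == det J then h (centered J) *+ (2 * n) ^ (k - #|block_rep|) else 0).
  move=> l0; rewrite (partition_big (E l)
    (fun J : {ffun 'I_k -> 'I_(2 * n)} => blk (centered J) == f)) /=; last first.
    by move=> u; rewrite cE.
  apply: eq_bigr => J bJ.
  have -> : (if l == det J then h (centered J) *+ (2 * n) ^ (k - #|block_rep|) else 0) =
      h (centered J) *+ (if l == det J then (2 * n) ^ (k - #|block_rep|) else 0)%N.
    by case: ifP.
  rewrite -(fib l J bJ l0) -sumr_const; apply: eq_big => [u|u].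
    rewrite inE -cE; apply/andP/idP => [[_]//|/eqP EJ]; by rewrite EJ.
  by rewrite -cE => /andP[_ /eqP ->].
under [RHS]eq_bigr => l l0 do rewrite inner//.
rewrite exchange_big /= -sumrMnl; apply: eq_bigr => J bJ.
have det0 : [forall t, isSome (rnd t) ==> (centered (det J) t == 0)].
  apply/forallP => t; apply/implyP; rewrite /centered ffunE; case: (rnd t) => //= _ _.
  by rewrite subrr.
rewrite (bigD1 (det J)) //= eqxx big1 ?addr0// => l /andP[_ /negPf ->].
by [].
Qed.

End Blocks.

(** * Expectations of products of matrix entries *)

Section EntryLaws.
Variable R : realType.

Definition entry (n : nat) (e : bool) (a b : 'I_n) (M : 'M[R[i]]_n) : R[i] :=
  if e then (M b a)^* else M a b.

Lemma adjoint_entry n (e : bool) (M : 'M[R[i]]_n) a b :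
  (if e then adjoint M else M) a b = entry e a b M.
Proof. by case: e => //; rewrite /adjoint !mxE. Qed.

(** The sigma-algebra on matrices is generated by the real and imaginary parts of the
    entries. *)
Lemma cmeasurable_entry n e (a b : 'I_n) :
  cmeasurable (entry e a b : mx_space R n -> R[i]).
Proof.
have mRe (i j : 'I_n) :
    measurable_fun [set: mx_space R n] (fun M : mx_space R n => complex.Re ((M : 'M[R[i]]_n) i j)).
  move=> _ U mU; rewrite setTI; apply: sub_sigma_algebra.
  by exists i, j, U; split=> //; left.
have mIm (i j : 'I_n) :
    measurable_fun [set: mx_space R n] (fun M : mx_space R n => complex.Im ((M : 'M[R[i]]_n) i j)).
  move=> _ U mU; rewrite setTI; apply: sub_sigma_algebra.
  by exists i, j, U; split=> //; right.
case: e; split; rewrite /entry; [|have := measurable_funN (mIm b a)|exact: mRe|exact: mIm].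
  apply: measurable_funT_ext (mRe b a) => M.
  by case: ((M : 'M[R[i]]_n) b a).
apply: measurable_funT_ext => M /=.
by case: ((M : 'M[R[i]]_n) b a).
Qed.

End EntryLaws.

Section Factorization.
Context (d : measure_display) (T : measurableType d) (R : realType).
Variable P : probability T R.
Variables (x y x' y' : nat -> int -> {RV P >-> R}).
Variables (rho1 rho2 rho3 rho4 rho5 rho6 : R).
Hypothesis hB : assumption_B x y x' y' rho1 rho2 rho3 rho4 rho5 rho6.
Local Notation cE := (cexpectation P).
Local Notation vec := (input_vec x y x' y').
Local Notation toep := (scaled_rtoeplitz x y x' y').

Lemma entry_scaled n e (a b : 'I_n) w :
  entry e a b (toep n w) = ((Num.sqrt (n%:R : R))^-1)%:C *
    input e (a.+1 + b.+1 <= n)%N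
      (vec n (if e then b%:Z - a%:Z else a%:Z - b%:Z) w).
Proof.
rewrite /entry /scaled_rtoeplitz /gtoeplitz !mxE; case: e.
  rewrite [(b.+1 + _)%N]addnC rmorphM /= /input; congr (_ * _).
    by rewrite oppr0.
  by rewrite /coord; case: ifP.
by rewrite /input /coord; case: ifP.
Qed.

Lemma finite_cmoments_entry_scaled n e (a b : 'I_n) :
  finite_cmoments P (fun w => entry e a b (toep n w)).
Proof.
rewrite (_ : (fun w => _) = fun w => ((Num.sqrt (n%:R : R))^-1)%:C *
    input e (a.+1 + b.+1 <= n)%N
      (vec n (if e then b%:Z - a%:Z else a%:Z - b%:Z) w)); last first.
  by apply/funext => w; rewrite entry_scaled.
by apply: finite_cmomentsM; [exact: finite_cmoments_cst|exact: finite_cmoments_input hB _ _ _ _].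
Qed.

Lemma measurable_toep n : measurable_fun [set: T] (toep n : T -> mx_space R n).
Proof.
apply: (@measurability _ _ _ (mx_space R n) _ _ (@mx_cylinders R n)) => //.
move=> _ [A [i [j [U [mU AE]]]] <-].
have [[mRe _] [mIm _]] := finite_cmoments_entry_scaled false i j.
by case: AE => ->; [exact: (mRe _ _ mU)|exact: (mIm _ _ mU)].
Qed.

Variables (I : finType) (k : nat) (rnd : 'I_k -> option I) (st : 'I_k -> bool).

Definition block_expectation n (J : 'I_k -> int) (b : 'I_k -> bool) : R[i] :=
  \prod_(s | block_rep rnd (block_of rnd (eq_disp J)) s)
    cE (fun w => \prod_(t | isSome (rnd t) && (block_of rnd (eq_disp J) t == s))
                   input (st t) (b t) (vec n (J s) w)).

Lemma big_random (G : 'I_k -> R[i]) (Q : pred 'I_k) :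
  \prod_(c : I) \prod_(t | (rnd t == Some c) && Q t) G t =
  \prod_(t | isSome (rnd t) && Q t) G t.
Proof.
rewrite (exchange_big_dep (fun t => isSome (rnd t) && Q t)) /=; last first.
  by move=> c t _ /andP[/eqP -> ->].
apply: eq_bigr => t /andP[rt ->]; case: (rnd t) rt => // c _.
under eq_bigl do rewrite andbT (inj_eq Some_inj) eq_sym.
by rewrite big_pred1_eq.
Qed.

Lemma big_undup_reps (A : pred 'I_k) (J : 'I_k -> int) (f : 'I_k -> 'I_k)
    (G : int -> R[i]) :
  (forall t, A t -> [/\ A (f t), J (f t) = J t & f (f t) = f t]) ->
  (forall s t, A s -> A t -> J s = J t -> f s = f t) ->
  \prod_(j <- undup [seq J t | t <- enum A]) G j =
  \prod_(s | A s && (f s == s)) G (J s).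
Proof.
move=> fA fJ; rewrite -[RHS](big_filter _ (fun s => A s && (f s == s))).
rewrite -(big_map J xpredT G); apply: perm_big; apply: uniq_perm.
- exact: undup_uniq.
- rewrite map_inj_in_uniq ?filter_uniq ?index_enum_uniq// => s t.
  rewrite !mem_filter => /andP[/andP[As /eqP fs] _] /andP[/andP[At /eqP ft] _] Jst.
  by rewrite -fs -ft; exact: fJ.
- move=> j; rewrite mem_undup; apply/mapP/mapP => -[t].
    rewrite mem_enum => At ->; have [Af Jf ff] := fA t At.
    by exists (f t) => //; rewrite mem_filter Af ff eqxx mem_index_enum.
  by rewrite mem_filter => /andP[/andP[At _] _] ->; exists t; rewrite ?mem_enum.
Qed.

Lemma block_expectationE n (J : 'I_k -> int) (b : 'I_k -> bool) :
  \prod_(c : I) cE (fun w => \prod_(t | rnd t == Some c)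
                      input (st t) (b t) (vec n (J t) w)) =
  block_expectation n J b.
Proof.
rewrite /block_expectation /block_rep -big_random.
apply: eq_bigr => c _.
rewrite (@cexpectation_prod_group _ _ T _ R P _ (vec n)
  (measurable_input_vec x y x' y' n) (B_indep hB n) _ J (fun t => rnd t == Some c)
  (fun t => input (st t) (b t)) (fun t _ => cmeasurable_input _ _ _)
  (fun t _ => finite_cmoments_input hB _ _ _ _)).
rewrite (big_undup_reps (f := block_of rnd (eq_disp J))).
- apply: eq_bigr => s /andP[/eqP rs /eqP bs].
  apply: eq_cexpectation => w; apply: eq_bigl => t.
  apply/andP/andP => [[/eqP rt /eqP Jts]|[rt /eqP bts]].
    by rewrite rt; split=> //; rewrite -bs block_of_eqE ?rt ?rs// Jts.
  have [e1 e2 _] := block_of_random J rt.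
  by rewrite -e1 bts rs eqxx -e2 bts.
- move=> t /eqP rt; have [|e1 e2 e3] := @block_of_random k I rnd J t; first by rewrite rt.
  by rewrite e1 rt eqxx.
- move=> s t /eqP rs /eqP rt Jst; apply/eqP; rewrite block_of_eqE ?rs ?rt//.
  exact/eqP.
Qed.

Variable B : I -> forall n, T -> 'M[R[i]]_n.
Hypothesis hcopies : forall n, independent_copies P
  (fun i => B i n : T -> mx_space R n) (toep n : T -> mx_space R n).

Definition random_factor n (a b : 'I_k -> 'I_n) (t : 'I_k) (w : T) : R[i] :=
  if rnd t is Some c then entry (st t) (a t) (b t) (B c n w) else 1.

Lemma copy_entry_law n c e (a b : 'I_n) : finite_cmoments P (fun w => entry e a b (B c n w)).
Proof.
have [mBn lawB _] := hcopies n.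
have := same_law_cexpectation (mBn c) (@measurable_toep n) (lawB c)
  (cmeasurable_entry R e a b) (finite_cmoments_entry_scaled e a b).
by case.
Qed.

Lemma finite_cmoments_random_factor n (a b : 'I_k -> 'I_n) t :
  finite_cmoments P (random_factor a b t).
Proof.
rewrite /random_factor; case: (rnd t) => [c|]; first exact: copy_entry_law.
exact: finite_cmoments_cst.
Qed.

(** Independence of the copies splits the expectation over the copies; each copy is
    then replaced by the Toeplitz matrix of the same law, where independence of the
    inputs over the index splits it further into blocks. *)
Lemma random_factor_expectation n (a b : 'I_k -> 'I_n) (J : 'I_k -> int) :
  (forall t, isSome (rnd t) ->
     J t = if st t then (b t)%:Z - (a t)%:Z else (a t)%:Z - (b t)%:Z) ->
  cE (fun w => \prod_t random_factor a b t w) =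
  ((Num.sqrt (n%:R : R))^-1)%:C ^+ #|[pred t | isSome (rnd t)]| *
  block_expectation n J (fun t => ((a t).+1 + (b t).+1 <= n)%N).
Proof.
move=> JE; have [mBn lawB indB] := hcopies n.
pose g c (M : mx_space R n) := \prod_(t | rnd t == Some c) entry (st t) (a t) (b t) M.
have mg c : c \in index_enum I -> cmeasurable (g c).
  by move=> _; apply: cmeasurable_prod => t _; exact: cmeasurable_entry.
have Ig c : c \in index_enum I -> finite_cmoments P (fun w => g c (B c n w)).
  by move=> _; apply: finite_cmoments_prod => t _; exact: copy_entry_law.
have -> : cE (fun w => \prod_t random_factor a b t w) =
    cE (fun w => \prod_(c <- index_enum I) g c (B c n w)).
  apply: eq_cexpectation => w.
  transitivity (\prod_(t | isSome (rnd t) && true) random_factor a b t w).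
    rewrite [LHS](bigID (fun t => isSome (rnd t))) /= [X in _ * X]big1 ?mulr1.
      by apply: eq_bigl => t; rewrite andbT.
    by move=> t; rewrite /random_factor; case: (rnd t).
  rewrite -big_random; apply: eq_bigr => c _; apply: eq_big => [t|t].
    by rewrite andbT.
  by rewrite andbT /random_factor => /eqP ->.
rewrite (@cexpectation_prod _ _ T (mx_space R n) R P I (fun c => B c n) mBn indB g
  (index_enum I) mg Ig (index_enum_uniq I)).
rewrite -block_expectationE -prodr_const.
have -> : \prod_(t in [pred t | isSome (rnd t)]) ((Num.sqrt (n%:R : R))^-1)%:C =
    \prod_(c : I) \prod_(t | rnd t == Some c) ((Num.sqrt (n%:R : R))^-1)%:C :> R[i].
  under [RHS]eq_bigr do under eq_bigl do rewrite -[_ == _]andbT.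
  by rewrite big_random; apply: eq_bigl => t; rewrite inE andbT.
rewrite -big_split /=; apply: eq_bigr => c _.
have mE : cmeasurable (fun M : mx_space R n =>
    \prod_(t | rnd t == Some c) entry (st t) (a t) (b t) M).
  by apply: cmeasurable_prod => t _; exact: cmeasurable_entry.
have IE : finite_cmoments P (fun w => \prod_(t | rnd t == Some c) entry (st t) (a t) (b t) (toep n w)).
  by apply: finite_cmoments_prod => t _; exact: finite_cmoments_entry_scaled.
rewrite (same_law_cexpectation (mBn c) (@measurable_toep n) (lawB c) mE IE).2.
rewrite -cexpectationZ; last first.
  by apply: finite_cmoments_prod => t _; exact: finite_cmoments_input hB _ _ _ _.
apply: eq_cexpectation => w; rewrite -big_split /=; apply: eq_bigr => t /eqP rt.
by rewrite entry_scaled JE// rt.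
Qed.

End Factorization.

(** * Convergence of sums over paths *)

Section AffinePaths.
Variables (F : finType) (k : nat) (rho st : 'I_k -> bool).

Lemma affine_mirror b (h : nat -> (F -> nat) -> int) :
  affine h -> affine (fun n u => mirror n b (h n u)).
Proof.
move=> ah; case: b => //=; apply: affineB => //; apply: affineB.
  exact: affine_scale.
exact: affine_cst.
Qed.

Lemma affine_pos (h0 : nat -> (F -> nat) -> int)
    (J : nat -> (F -> nat) -> 'I_k -> int) t :
  affine h0 -> (forall t, affine (fun n u => J n u t)) ->
  affine (fun n u => pos rho st n (h0 n u) (J n u) t).
Proof.
move=> a0 aJ; elim: t => [|t IH] //=.
case: insubP => [s _ _|_]; last exact: IH.
apply: affineD; first exact: affine_mirror.
by rewrite /sgnd; case: (st s); [|apply: affineN]; exact: aJ.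
Qed.

(** A start and a displacement vector form one point of a box with one more
    coordinate. *)
Lemma sum_ffun_option (V : zmodType) (K A : finType) (h : {ffun option K -> A} -> V) :
  \sum_(a : A) \sum_(u : {ffun K -> A}) h [ffun o => if o is Some t then u t else a] =
  \sum_w h w.
Proof.
rewrite pair_big /=.
pose g (w : {ffun option K -> A}) : A * {ffun K -> A} := (w None, [ffun t => w (Some t)]).
rewrite [RHS](reindex (fun z : A * {ffun K -> A} =>
  [ffun o : option K => if o is Some t then z.2 t else z.1])) //=.
apply: onW_bij; exists g => [[a u]|w].
  by rewrite /g ffunE; congr pair; apply/ffunP => t; rewrite !ffunE.
by apply/ffunP => -[t|]; rewrite !ffunE.
Qed.

End AffinePaths.

(** With q the square root of n, this compares the normalization of a word having
    a + 2 * r random letters with the number of parameters of a pattern of r blocks. *)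
Lemma norming_identity (A : fieldType) (q D : A) a b r : 2 != 0 :> A -> q != 0 ->
  (q ^+ 2)^-1 * q^-1 ^+ (a + 2 * r) / (2 * q ^+ 2) ^+ b *
    ((2 * q ^+ 2) * ((2 * q ^+ 2) ^+ (b + r) * D)) =
  2 ^+ r.+1 * q^-1 ^+ a * D.
Proof.
move=> A2 q0; have z0 : 2 * q ^+ 2 != 0 by rewrite mulf_neq0// expf_neq0.
have -> : q^-1 ^+ (a + 2 * r) = q^-1 ^+ a * (q ^+ 2)^-1 ^+ r.
  by rewrite exprD exprM !exprVn.
rewrite [(2 * q ^+ 2) ^+ (b + r)]exprD [2 ^+ r.+1]exprS.
have zb : (2 * q ^+ 2) ^+ b != 0 by rewrite expf_neq0.
have -> : (2 * q ^+ 2) ^+ r = 2 ^+ r * (q ^+ 2) ^+ r by rewrite exprMn.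
rewrite [(q ^+ 2)^-1 ^+ r]exprVn; have qr : (q ^+ 2) ^+ r != 0 by rewrite !expf_neq0.
move: ((2 * q ^+ 2) ^+ b) zb ((q ^+ 2) ^+ r) qr (2 ^+ r) (q^-1 ^+ a).
by move=> z z0' y y0 u v; field; rewrite z0' y0.
Qed.

Section WordAverage.
Context (d : measure_display) (T : measurableType d) (R : realType).
Variable P : probability T R.
Variables (x y x' y' : nat -> int -> {RV P >-> R}).
Variables (rho1 rho2 rho3 rho4 rho5 rho6 s1 s2 : R).
Hypothesis hB : assumption_B x y x' y' rho1 rho2 rho3 rho4 rho5 rho6.
Hypothesis hs : constant_second_moments x x' s1 s2.
Local Notation normc := (@Normc.normc R).
Local Notation cE := (cexpectation P).
Local Notation vec := (input_vec x y x' y').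
Variables (I : finType) (k : nat) (rho st : 'I_k -> bool) (rnd : 'I_k -> option I).
Variables (dl dh : 'I_k -> int -> R[i]).
Hypothesis dsum : forall t, exists K : R, forall n,
  \sum_(j < 2 * n) (normc (dl t (j%:Z - n%:Z)) + normc (dh t (j%:Z - n%:Z))) <= K.
Local Notation pos := (pos rho st).
Local Notation Q := (block_expectation x y x' y' rnd st).
Local Notation blk J := (block_of rnd (eq_disp J)).

(** Whether the letter t reads the first of the two input sequences. *)
Definition low n v0 J (t : 'I_k) : bool := 0 <= n%:Z - 2 - pos n v0 J t - pos n v0 J t.+1.

(** The product of the fixed coefficients met along a path, times the expectation of
    the random ones without their normalization. *)
Definition path_weight n v0 (J : 'I_k -> int) : R[i] :=
  \prod_(t | ~~ isSome (rnd t)) (if low n v0 J t then dl t (J t) else dh t (J t)) *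
  Q n J (low n v0 J).

Definition random_count := #|[pred t | isSome (rnd t)]|.

Definition norming n : R[i] := n%:R^-1 * ((Num.sqrt (n%:R : R))^-1)%:C ^+ random_count.

Definition valid_weight n v0 J : R[i] :=
  if valid_path rho st n v0 J then path_weight n v0 J else 0.

(** phi of the word, as a sum over starts and displacements. *)
Definition word_average n : R[i] :=
  norming n * \sum_(v0 < 2 * n) \sum_(J : {ffun 'I_k -> 'I_(2 * n)})
    valid_weight n v0%:Z (centered J).

(** Summable weights dominating the dependence on the displacements of the fixed
    letters; the random letters have l t = 0. *)
Definition delta (t : 'I_k) (j : int) : R :=
  if rnd t then (j == 0)%:R else normc (dl t j) + normc (dh t j).

Lemma delta_ge0 t j : 0 <= delta t j.
Proof. by rewrite /delta; case: ifP => // _; rewrite addr_ge0 ?normc_ge0. Qed.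

Lemma delta_sum t : exists K : R, forall n, \sum_(j < 2 * n) delta t (j%:Z - n%:Z) <= K.
Proof.
rewrite /delta; case: (rnd t) => [c|] /=; last exact: dsum.
exists 1 => n; case: n => [|n]; first by rewrite big_ord0.
have lt : (n.+1 < 2 * n.+1)%N by lia.
rewrite (bigD1 (Ordinal lt)) //= subrr big1 ?addr0// => j jn.
rewrite subr_eq0 eqz_nat; case: eqP => // e; case/eqP: jn.
exact: val_inj.
Qed.

Section Pattern.
Variable f : {ffun 'I_k -> 'I_k}.
Local Notation rep := (block_rep rnd f).
Local Notation r := #|rep|.
Definition block t : pred 'I_k := fun t' => isSome (rnd t') && (f t' == t).

Definition dummy_zero (l : 'I_k -> int) := [forall t, isSome (rnd t) ==> (l t == 0)].

(** The part of word_average with pattern f and with fixed displacements l. *)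
Definition pattern_term n (l : 'I_k -> int) : R[i] :=
  if dummy_zero l then
    norming n * ((2 * n)%:R ^+ (k - r))^-1 *
    \sum_(v0 < 2 * n) \sum_(u : {ffun 'I_k -> 'I_(2 * n)} |
         blk (mix_disp rnd f n l (fun t => u t)) == f)
      valid_weight n v0%:Z (mix_disp rnd f n l (fun t => u t))
  else 0.

Lemma pattern_termE n : (0 < n)%N ->
  norming n * \sum_(v0 < 2 * n) \sum_(J : {ffun 'I_k -> 'I_(2 * n)} | blk (centered J) == f)
    valid_weight n v0%:Z (centered J) =
  \sum_(l : {ffun 'I_k -> 'I_(2 * n)}) pattern_term n (centered l).
Proof.
move=> n0; rewrite /pattern_term -big_mkcond /=.
rewrite -[RHS]mulr_sumr -[RHS]mulrA; congr (_ * _).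
rewrite [in RHS]exchange_big /= mulr_sumr; apply: eq_bigr => v0 _.
have := sum_mix_disp rnd f (fun J => valid_weight n v0%:Z J) n0.
move=> /(congr1 (fun z => ((2 * n)%:R ^+ (k - r))^-1 * z)).
rewrite -[_ *+ (_ ^ _)]mulr_natl mulrA natrX mulVf ?mul1r//.
by rewrite expf_neq0// pnatr_eq0 -lt0n muln_gt0.
Qed.

(** The inputs are centered. *)
Lemma pattern_term_singleton (t : 'I_k) n l : rep t -> #|block t| = 1%N ->
  pattern_term n l = 0.
Proof.
move=> rt b1; rewrite /pattern_term; case: ifP => // _.
rewrite big1 ?mulr0// => v0 _; rewrite big1// => u /eqP bf.
rewrite /valid_weight; case: ifP => // _; rewrite /path_weight /block_expectation bf.
rewrite [X in _ * X](bigD1 t)//=.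
have [t' bt] := mem_card1 b1.
have /eqP tt' : t \in pred1 t' by rewrite -bt; exact: rt.
have {}bt z : block t z = pred1 t z by rewrite [in RHS]tt'; exact: (bt z).
under eq_cexpectation do rewrite (eq_bigl _ _ bt) big_pred1_eq.
by rewrite (cexpectation_input_eq0 hB) mul0r mulr0.
Qed.

Lemma path_weight_le : exists2 C : R, 0 <= C & forall n v0 J, blk J = f ->
  normc (path_weight n v0 J) <=
  \prod_(t | ~~ isSome (rnd t)) (normc (dl t (J t)) + normc (dh t (J t))) * C ^+ r.
Proof.
have [C C0 CP] := block_bound hB 'I_k.
exists C => // n v0 J bf; rewrite /path_weight Normc.normcM ler_pM ?normc_ge0//.
  rewrite normc_prod; apply: ler_prod => t _; rewrite normc_ge0 /=.
  by case: ifP => _; rewrite ?lerDl ?lerDr normc_ge0.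
rewrite /block_expectation bf normc_prod -prodr_const.
by apply: ler_prod => t _; rewrite normc_ge0 /= CP.
Qed.

Lemma normc_norming n : normc (norming n) =
  n%:R^-1 * (Num.sqrt n%:R)^-1 ^+ random_count :> R.
Proof.
rewrite /norming Normc.normcM.
have -> : n%:R^-1 = (n%:R^-1)%:C :> R[i] by rewrite fmorphV rmorph_nat.
by rewrite -rmorphXn !normc_real !ger0_norm ?exprn_ge0 ?invr_ge0 ?ler0n ?sqrtr_ge0.
Qed.

Lemma rep_le_k : (r <= k)%N.
Proof. by have := max_card rep; rewrite card_ord. Qed.

(** There are of the order of n^(1 + r) choices of a start and of the displacements
    of r blocks, against a normalization n^(- 1 - random_count / 2). *)
Lemma pattern_term_bound : (2 * r <= random_count)%N -> exists2 C : R, 0 <= C &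
  forall n l, normc (pattern_term n l) <=
    C * (Num.sqrt n%:R)^-1 ^+ (random_count - 2 * r) * \prod_t delta t (l t).
Proof.
move=> rp; have [C C0 CP] := path_weight_le.
exists (2 ^+ r.+1 * C ^+ r); first by rewrite mulr_ge0 ?exprn_ge0.
move=> n l; have D0 : 0 <= \prod_t delta t (l t).
  by apply: prodr_ge0 => t _; exact: delta_ge0.
have q0 : 0 <= (Num.sqrt (n%:R : R))^-1 by rewrite invr_ge0 sqrtr_ge0.
have RHS0 : 0 <= 2 ^+ r.+1 * C ^+ r * (Num.sqrt n%:R)^-1 ^+ (random_count - 2 * r) *
    \prod_t delta t (l t) by rewrite !mulr_ge0 ?exprn_ge0.
rewrite /pattern_term; case: ifP => [dz|_]; last by rewrite Normc.normc0.
have [n0|n0] := posnP n.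
  by move: RHS0; rewrite n0 {1}/norming invr0 !mul0r Normc.normc0.
rewrite Normc.normcM [X in X * _]Normc.normcM normc_norming Normc.normcV.
have -> : normc ((2 * n)%:R ^+ (k - r)) = (2 * n)%:R ^+ (k - r).
  rewrite -[(2 * n)%:R in LHS](rmorph_nat (real_complex R)) -rmorphXn normc_real.
  by rewrite ger0_norm// exprn_ge0.
have wB v0 (u : {ffun 'I_k -> 'I_(2 * n)}) :
    blk (mix_disp rnd f n l (fun t => u t)) = f ->
    normc (valid_weight n v0 (mix_disp rnd f n l (fun t => u t))) <=
    \prod_t delta t (l t) * C ^+ r.
  move=> bf; have B0 : 0 <= \prod_t delta t (l t) * C ^+ r by rewrite mulr_ge0 ?exprn_ge0.
  rewrite /valid_weight; case: ifP => _; last by rewrite Normc.normc0.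
  rewrite (le_trans (CP _ _ _ bf))// ler_wpM2r ?exprn_ge0//.
  rewrite [leRHS](bigID (fun t => isSome (rnd t))) /= [X in _ <= X * _]big1 ?mul1r.
    rewrite le_eqVlt; apply/orP; left; apply/eqP; apply: eq_bigr => t.
    by rewrite /delta /mix_disp; case: (rnd t).
  move=> t rt; have := forallP dz t; rewrite rt /= => /eqP ->.
  by rewrite /delta; case: (rnd t) rt => // c _; rewrite eqxx.
have sB : normc (\sum_(v0 < 2 * n) \sum_(u : {ffun 'I_k -> 'I_(2 * n)} |
         blk (mix_disp rnd f n l (fun t => u t)) == f)
      valid_weight n v0%:Z (mix_disp rnd f n l (fun t => u t))) <=
    (2 * n)%:R * ((2 * n)%:R ^+ k * (\prod_t delta t (l t) * C ^+ r)).
  rewrite (le_trans (ler_normc_sum _ _ _))//.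
  apply: (@le_trans _ _ (\sum_(v0 < 2 * n) ((2 * n)%:R ^+ k * (\prod_t delta t (l t) * C ^+ r)))).
    apply: ler_sum => v0 _; rewrite (le_trans (ler_normc_sum _ _ _))//.
    apply: (@le_trans _ _ (\sum_(u : {ffun 'I_k -> 'I_(2 * n)}) \prod_t delta t (l t) * C ^+ r)).
      rewrite [leRHS](bigID (fun u : {ffun 'I_k -> 'I_(2 * n)} =>
        blk (mix_disp rnd f n l (fun t => u t)) == f)) /=.
      rewrite -[leLHS]addr0 lerD//.
        by apply: ler_sum => u /eqP bf; exact: wB.
      by apply: sumr_ge0 => u _; rewrite mulr_ge0 ?exprn_ge0.
    by rewrite sumr_const card_ffun !card_ord -[leLHS]mulr_natl natrX.
  by rewrite sumr_const card_ord -[leLHS]mulr_natl.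
apply: le_trans (ler_wpM2l _ sB) _.
  by rewrite !mulr_ge0 ?invr_ge0 ?exprn_ge0.
rewrite le_eqVlt; apply/orP; left; apply/eqP.
have q1 : Num.sqrt (n%:R : R) != 0 by rewrite gt_eqF// sqrtr_gt0 ltr0n.
have nq : n%:R = Num.sqrt (n%:R : R) ^+ 2 by rewrite sqr_sqrtr.
have kE : (2 * n)%:R ^+ k = (2 * n)%:R ^+ (k - r + r) :> R by rewrite subnK// rep_le_k.
have pE : (Num.sqrt (n%:R : R))^-1 ^+ random_count =
    (Num.sqrt n%:R)^-1 ^+ (random_count - 2 * r + 2 * r) by rewrite subnK.
rewrite kE pE natrM nq sqrtr_sqr ger0_norm ?sqrtr_ge0//.
have -> : 2 ^+ r.+1 * C ^+ r * (Num.sqrt n%:R)^-1 ^+ (random_count - 2 * r) *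
    \prod_t delta t (l t) = 2 ^+ r.+1 * (Num.sqrt n%:R)^-1 ^+ (random_count - 2 * r) *
    (\prod_t delta t (l t) * C ^+ r) by ring.
exact: norming_identity.
Qed.

Lemma pair_block_expectation t (b : 'I_k -> bool) n j : #|block t| = 2%N ->
  cE (fun w => \prod_(t' | block t t') input (st t') (b t') (vec n j w)) =
  cE (fun w => \prod_(t' | block t t') input (st t') (b t') (vec 0 0 w)).
Proof.
move=> b2; have /cards2P[t1 [t2 [t12 bE]]] : #|finset (block t)| == 2%N.
  by rewrite cardsE b2.
have bigE n' j' w : \prod_(t' | block t t') input (st t') (b t') (vec n' j' w) =
    input (st t1) (b t1) (vec n' j' w) * input (st t2) (b t2) (vec n' j' w).
  rewrite (eq_bigl (mem (finset (block t)))); last by move=> z; rewrite /= inE.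
  by rewrite bE big_setU1 ?inE// big_set1.
under eq_cexpectation do rewrite bigE.
under [in RHS]eq_cexpectation do rewrite bigE.
exact: cexpectation_pair hB hs _ _ _ _ _ _.
Qed.

Section Lattice.
Variable l : 'I_k -> int.

Definition sign_index : finType := (('I_k.+1 * bool) + ('I_k + ('I_k * 'I_k + bool)))%type.

Let disp_form n (w : option 'I_k -> nat) := mix_disp rnd f n l (fun t => w (Some t)).
Let pos_form n (w : option 'I_k -> nat) m := pos n (w None)%:Z (disp_form n w) m.

(** The inequalities deciding the weight of a path: the vertices are in range, the
    sequence read by each letter, which displacements are equal, and whether the path
    is closed. *)
Definition path_form (z : sign_index) (n : nat) (w : option 'I_k -> nat) : int :=
  match z with
  | inl (t, true) => pos_form n w t
  | inl (t, false) => n%:Z - 1 - pos_form n w t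
  | inr (inl t) => n%:Z - 2 - pos_form n w t - pos_form n w t.+1
  | inr (inr (inl (t, t'))) => disp_form n w t - disp_form n w t'
  | inr (inr (inr true)) => pos_form n w k - (w None)%:Z
  | inr (inr (inr false)) => (w None)%:Z - pos_form n w k
  end.

(** The weight of a path as a function of the signs of the path_form; pair blocks
    are evaluated at n = j = 0 since they do not depend on n and j. *)
Definition sign_weight (sg : {ffun sign_index -> bool}) : R[i] :=
  if [&& [forall z, sg (inl z)], sg (inr (inr (inr true))), sg (inr (inr (inr false)))
       & block_of rnd (fun t t' => sg (inr (inr (inl (t, t')))) &&
                                   sg (inr (inr (inl (t', t))))) == f]
  then \prod_(t | ~~ isSome (rnd t))
         (if sg (inr (inl t)) then dl t (l t) else dh t (l t)) *
       \prod_(s | rep s) cE (fun w => \prod_(t | block s t)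
          input (st t) (sg (inr (inl t))) (vec 0 0 w))
  else 0.

Lemma affine_path_form z : affine (path_form z).
Proof.
have aJ t : affine (fun n w => disp_form n w t).
  rewrite /disp_form /mix_disp; case: (rnd t) => [c|] /=; last exact: affine_cst.
  by apply: affineB; [exact: affine_coord|exact: affine_scale].
have aP m : affine (fun n w => pos_form n w m).
  by apply: affine_pos => //; exact: affine_coord.
case: z => [[t []]|[t|[[t t']|[]]]] /=; repeat first
  [exact: aP|exact: aJ|exact: affine_scale|exact: affine_cst|exact: affine_coord|apply: affineB].
Qed.

Lemma sign_weightE n (w : option 'I_k -> nat) :
  (forall s, rep s -> #|block s| = 2%N) ->
  sign_weight [ffun z => 0 <= path_form z n w] =
  if blk (disp_form n w) == f then valid_weight n (w None)%:Z (disp_form n w) else 0.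
Proof.
move=> b2; rewrite /sign_weight; set sg := [ffun z => _].
have eqE : (fun t t' => sg (inr (inr (inl (t, t')))) && sg (inr (inr (inl (t', t))))) =
    eq_disp (disp_form n w).
  apply/funext => t; apply/funext => t'; rewrite !ffunE /= /eq_disp.
  by rewrite !subr_ge0 -eq_le eq_sym.
have vE : [&& [forall z, sg (inl z)], sg (inr (inr (inr true))) & sg (inr (inr (inr false)))] =
    valid_path rho st n (w None)%:Z (disp_form n w).
  rewrite /valid_path !ffunE /= !subr_ge0 -eq_le [X in _ && X]eq_sym; congr (_ && _).
  apply/forallP/forallP => [h t|h [t b]].
    have := h (t, true); have := h (t, false); rewrite !ffunE /=.
    rewrite /pos_form; move: (pos _ _ _ _) => a; lia.
  have := h t; rewrite ffunE /=; case: b; rewrite /pos_form; move: (pos _ _ _ _) => a; lia.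
rewrite eqE [X in if X then _ else _](_ : _ =
  valid_path rho st n (w None)%:Z (disp_form n w) && (blk (disp_form n w) == f)); last first.
  by rewrite -vE -!andbA.
rewrite /valid_weight andbC; case: eqP => //= bf; case: ifP => // _.
rewrite /path_weight /block_expectation bf; congr (_ * _).
  apply: eq_bigr => t rt; rewrite !ffunE /= /low -/(pos_form n w t) -/(pos_form n w t.+1).
  by rewrite /disp_form /mix_disp; case: (rnd t) rt.
apply: eq_bigr => s rs; rewrite -(pair_block_expectation _ n (disp_form n w s) (b2 s rs)).
by apply: eq_cexpectation => z; apply: eq_bigr => t _; rewrite ffunE.
Qed.

(** When all blocks are pairs, the term is a lattice average. A nontrivial closing
    condition confines the points to a hyperplane, and then the limit is 0. *)
Lemma pattern_term_lattice : (forall s, rep s -> #|block s| = 2%N) ->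
  random_count = (2 * r)%N -> cconverges (fun n => pattern_term n l).
Proof.
move=> b2 pr; case/boolP: (dummy_zero l) => dz; last first.
  by rewrite /pattern_term (negPf dz); exact: cconverges_cst.
(* The box has side 2 * n whereas lattice averages are divided by powers of n. *)
have cv := cconvergesZ (2 ^+ (k - r))^-1
  (lattice_average_cconverges sign_weight affine_path_form).
apply: (cconverges_eventually (N := 1) _ cv) => n n0.
rewrite /pattern_term dz card_option card_ord.
under [in RHS]eq_bigr do rewrite sign_weightE//.
rewrite -(sum_ffun_option (fun w : {ffun option 'I_k -> 'I_(2 * n)} =>
  if blk (disp_form n (fun z => w z)) == f
  then valid_weight n (w None)%:Z (disp_form n (fun z => w z)) else 0)).
rewrite mulrA; congr (_ * _).
  rewrite /norming pr; have q1 : Num.sqrt (n%:R : R) != 0.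
    by rewrite gt_eqF// sqrtr_gt0 ltr0n.
  have -> : ((Num.sqrt (n%:R : R))^-1)%:C ^+ (2 * r) = n%:R^-1 ^+ r :> R[i].
    rewrite exprM -[_ ^+ 2]rmorphXn [_ ^-1 ^+ 2]exprVn sqr_sqrtr// fmorphV.
    by rewrite rmorph_nat.
  have -> : n%:R^-1 ^+ k.+1 = n%:R^-1 * (n%:R^-1 ^+ (k - r) * n%:R^-1 ^+ r) :> R[i].
    by rewrite -exprD subnK ?rep_le_k// -exprS.
  rewrite natrM exprMn invfM !exprVn; ring.
apply: eq_bigr => v0 _; rewrite [LHS]big_mkcond /=; apply: eq_bigr => u _.
rewrite ffunE.
have -> : disp_form n (fun z => [ffun o => if o is Some t then u t else v0] z) =
    mix_disp rnd f n l (fun t => u t).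
  by apply/funext => t; rewrite /disp_form /mix_disp !ffunE.
by [].
Qed.

End Lattice.

(** A pattern with a block of one letter contributes 0. Otherwise 2 * r is at most the
    number of random letters, which makes the terms bounded by a summable function of
    l, and tannery leaves the limit for fixed l: it is 0 if the inequality is strict,
    and if it is an equality all blocks are pairs. *)
Lemma pattern_cconverges :
  cconverges (fun n => norming n * \sum_(v0 < 2 * n)
    \sum_(J : {ffun 'I_k -> 'I_(2 * n)} | blk (centered J) == f)
      valid_weight n v0%:Z (centered J)).
Proof.
have [[J0 J0f]|noJ] := pselect (exists J0, blk J0 = f); last first.
  apply: (cconverges_eventually (N := 0) _ (cconverges_cst 0)) => n _.
  rewrite big1 ?mulr0// => v0 _; rewrite big_pred0// => J.
  by apply/eqP => Jf; apply: noJ; exists (centered J).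
have repf t : isSome (rnd t) -> rep (f t).
  by move=> rt; have [e1 _ e3] := block_of_random J0 rt; rewrite -J0f /block_rep e1 rt e3 eqxx.
have fin : cconverges (fun n => \sum_(l : {ffun 'I_k -> 'I_(2 * n)}) pattern_term n (centered l)) ->
    cconverges (fun n => norming n * \sum_(v0 < 2 * n)
    \sum_(J : {ffun 'I_k -> 'I_(2 * n)} | blk (centered J) == f)
      valid_weight n v0%:Z (centered J)).
  by apply: (cconverges_eventually (N := 1)) => n n0; exact: pattern_termE.
apply: fin.
have [/existsP[t /andP[rt /eqP b1]]|nosing] := boolP [exists t, rep t && (#|block t| == 1%N)].
  apply: (cconverges_eventually (N := 0) _ (cconverges_cst 0)) => n _.
  by rewrite big1// => l _; exact: pattern_term_singleton rt b1.
have b2 t : rep t -> (2 <= #|block t|)%N.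
  move=> rt; move: nosing; rewrite negb_exists => /forallP/(_ t); rewrite rt /=.
  have : (0 < #|block t|)%N by apply/card_gt0P; exists t; exact: rt.
  by case: #|block t| => [|[|]].
have pE : random_count = (\sum_(t | rep t) #|block t|)%N.
  rewrite /random_count -sum1_card (partition_big f rep) /=; last first.
    by move=> t; rewrite inE => /repf.
  by apply: eq_bigr => t _; rewrite -sum1_card; apply: eq_bigl => t'; rewrite inE.
have rp : (2 * r <= random_count)%N.
  by rewrite pE mulnC -sum_nat_const; apply: leq_sum => t /b2.
have [C C0 CP] := pattern_term_bound rp.
apply: (tannery (delta := delta) (C := C)).
- exact: delta_ge0.
- exact: delta_sum.
- move=> n l; apply: le_trans (CP n l) _.
  rewrite ler_wpM2r ?prodr_ge0// => [t _|]; first exact: delta_ge0.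
  rewrite -[leRHS]mulr1 ler_wpM2l// exprn_ile1 ?invr_ge0 ?sqrtr_ge0//.
  case: n => [|n]; first by rewrite sqrtr0 invr0.
  rewrite invf_le1 ?sqrtr_gt0 ?ltr0n// -[leLHS]sqrtr1 ler_sqrt ?ler0n//.
  by rewrite ler1n.
move=> l; have [p2|p2] := eqVneq random_count (2 * r)%N.
  apply: pattern_term_lattice => // t rt; apply/eqP; rewrite eqn_leq b2// andbT.
  rewrite leqNgt; apply/negP => b3.
  suff : (\sum_(i | rep i) 2 < \sum_(i | rep i) #|block i|)%N.
    by rewrite -pE p2 sum_nat_const mulnC ltnn.
  rewrite (bigD1 t)//= [ltnRHS](bigD1 t)//= -addSn leq_add//.
  by apply: leq_sum => i /andP[/b2].
apply: (cconverges_to0 (C := C * \prod_t delta t (l t))) => n n0.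
apply: le_trans (CP n l) _; rewrite mulrAC ler_wpM2l//.
  by rewrite mulr_ge0// prodr_ge0// => t _; exact: delta_ge0.
have : (0 < random_count - 2 * r)%N by rewrite subn_gt0 ltn_neqAle eq_sym p2.
case: (_ - _)%N => // m _; rewrite exprS -[leRHS]mulr1 ler_wpM2l ?invr_ge0 ?sqrtr_ge0//.
rewrite exprn_ile1 ?invr_ge0 ?sqrtr_ge0// invf_le1 ?sqrtr_gt0 ?ltr0n//.
by rewrite -[leLHS]sqrtr1 ler_sqrt ?ler0n// ler1n.
Qed.

End Pattern.

Lemma word_average_cconverges : cconverges word_average.
Proof.
have cv := cconverges_sum (Q := xpredT) (index_enum {ffun 'I_k -> 'I_k})
  (fun f _ => pattern_cconverges f).
apply: (cconverges_eventually (N := 0) _ cv) => n _.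
rewrite /word_average -[RHS]mulr_sumr; congr (_ * _); rewrite [RHS]exchange_big /=.
apply: eq_bigr => v0 _.
rewrite (partition_big (fun J : {ffun 'I_k -> 'I_(2 * n)} => blk (centered J)) xpredT) //=.
Qed.

End WordAverage.

(** * Joint convergence *)

Section Words.
Context (d : measure_display) (T : measurableType d) (R : realType).
Variable P : probability T R.
Variables (x y x' y' : nat -> int -> {RV P >-> R}).
Variables (rho1 rho2 rho3 rho4 rho5 rho6 s1 s2 : R).
Hypothesis hB : assumption_B x y x' y' rho1 rho2 rho3 rho4 rho5 rho6.
Hypothesis hs : constant_second_moments x x' s1 s2.
Local Notation normc := (@Normc.normc R).
Local Notation cE := (cexpectation P).
Local Notation toep := (scaled_rtoeplitz x y x' y').
Variables (I : finType) (B : I -> forall n, T -> 'M[R[i]]_n).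
Hypothesis hcopies : forall n, independent_copies P
  (fun i => B i n : T -> mx_space R n) (toep n : T -> mx_space R n).
Variables (d' d'' : I -> int -> R[i]).
Hypotheses (hd' : forall i, abs_summable (d' i)) (hd'' : forall i, abs_summable (d'' i)).

(** The partial sums over centered intervals are bounded by the unordered sum. *)
Lemma abs_summable_bounded (c : int -> R[i]) : abs_summable c ->
  exists K : R, forall n, \sum_(j < 2 * n) normc (c (j%:Z - n%:Z)) <= K.
Proof.
move=> cs; exists (fine (\esum_(j in [set: int]) (normc (c j))%:E)%E) => n.
have fin : (\esum_(j in [set: int]) (normc (c j))%:E)%E \is a fin_num.
  rewrite ge0_fin_numE ?esum_ge0//; last by move=> j _; rewrite lee_fin normc_ge0.
  by move: cs; rewrite /abs_summable /summable; under eq_esum do rewrite gee0_abs ?lee_fin ?normc_ge0//.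
rewrite -lee_fin fineK//.
pose s : seq int := [seq (nat_of_ord j)%:Z - n%:Z | j <- enum 'I_(2 * n)].
have us : uniq s.
  rewrite map_inj_uniq ?enum_uniq// => j1 j2 /addIr [] ?; exact: val_inj.
apply: esum_ge; exists [set` s]; first by split; [exact: finite_seq|].
rewrite -fsbig_seq// /s big_map big_enum /=.
by rewrite -sumEFin.
Qed.

Variables (k : nat) (word : 'I_k -> option (I + I)) (eps : 'I_k -> bool).

Definition letter_reflects (l : 'I_k) : bool := if word l is None then true else false.

Definition letter_copy (l : 'I_k) : option I :=
  if word l is Some (inl c) then Some c else None.

(** P has the coefficients of the Kronecker delta: only the exact mirror image of a
    vertex is allowed. *)
Definition letter_coef (dd : I -> int -> R[i]) (l : 'I_k) (j : int) : R[i] :=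
  match word l with
  | None => (j == 0)%:R
  | Some (inl _) => 0
  | Some (inr c) => if eps l then (dd c j)^* else dd c j
  end.

Local Notation dl := (letter_coef d').
Local Notation dh := (letter_coef d'').

Lemma letter_coef_bounded (dd : I -> int -> R[i]) t : (forall i, abs_summable (dd i)) ->
  exists K : R, forall n, \sum_(j < 2 * n) normc (letter_coef dd t (j%:Z - n%:Z)) <= K.
Proof.
move=> hdd; rewrite /letter_coef; case: (word t) => [[c|c]|].
- by exists 0 => n; rewrite big1// => j _; rewrite Normc.normc0.
- have [K HK] := abs_summable_bounded (hdd c); exists K => n.
  apply: le_trans (HK n); apply: ler_sum => j _; case: (eps t) => //.
  by case: (dd c _) => a b /=; rewrite sqrrN.
- exists 1 => -[|n]; first by rewrite big_ord0.
  have lt : (n.+1 < 2 * n.+1)%N by lia.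
  rewrite (bigD1 (Ordinal lt)) //= subrr eqxx Normc.normc1 big1 ?addr0// => j jn.
  rewrite subr_eq0 eqz_nat; case: eqP => [e|_]; last by rewrite Normc.normc0.
  by case/eqP: jn; exact: val_inj.
Qed.

Lemma letter_coefs_bounded t : exists K : R, forall n,
  \sum_(j < 2 * n) (normc (dl t (j%:Z - n%:Z)) + normc (dh t (j%:Z - n%:Z))) <= K.
Proof.
have [K1 H1] := letter_coef_bounded t hd'.
have [K2 H2] := letter_coef_bounded t hd''.
by exists (K1 + K2) => n; rewrite big_split lerD.
Qed.

Definition letter n (w : T) (l : 'I_k) : 'M[R[i]]_n :=
  if eps l then adjoint (PBD_family B (fun i n => gtoeplitz n (d' i) (d'' i)) (word l) n w)
  else PBD_family B (fun i n => gtoeplitz n (d' i) (d'' i)) (word l) n w.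

Definition fixed_factor n (a b : 'I_n) (l : 'I_k) : R[i] :=
  if letter_copy l then 1 else
  if (a.+1 + b.+1 <= n)%N then dl l (disp letter_reflects eps n l a%:Z b%:Z)
  else dh l (disp letter_reflects eps n l a%:Z b%:Z).

(** Each entry of a letter is a fixed factor times a random one, one of them being 1. *)
Lemma letterE n w (a b : 'I_k -> 'I_n) l :
  letter n w l (a l) (b l) =
  fixed_factor (a l) (b l) l * random_factor letter_copy eps B a b l w.
Proof.
rewrite /letter adjoint_entry /fixed_factor /random_factor /letter_copy /letter_coef /disp /letter_reflects.
case: (word l) => [[c|c]|] /=; first by rewrite mul1r.
  rewrite mulr1 /entry /gtoeplitz !mxE /sgnd; case: (eps l).
    by rewrite [((b l).+1 + _)%N]addnC; case: ifP.
  by rewrite opprB; case: ifP.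
rewrite mulr1 /entry /backward_id !mxE.
have -> : (if eps l then (((b l).+1 + (a l).+1 == n.+1)%N%:R)^* else
    ((a l).+1 + (b l).+1 == n.+1)%N%:R) = ((a l).+1 + (b l).+1 == n.+1)%N%:R :> R[i].
  by case: (eps l) => //; rewrite conjc_nat addnC.
rewrite if_same; congr (_%:R); rewrite /sgnd; have := ltn_ord (a l); have := ltn_ord (b l).
by case: (eps l) => /= h1 h2; apply/eqP/eqP; lia.
Qed.

Lemma phi_word_average n : (0 < n)%N ->
  phi P (fun w => \prod_(l < k) letter n w l) =
  word_average x y x' y' letter_reflects eps letter_copy dl dh n.
Proof.
move=> n0; rewrite /phi /word_average /norming /valid_weight -mulrA; congr (_ * _).
rewrite -(sum_paths letter_reflects eps (path_weight x y x' y' letter_reflects eps letter_copy dl dh n) n0).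
pose va (v : {ffun 'I_k.+1 -> 'I_n}) (l : 'I_k) := v (widen_ord (leqnSn k) l).
pose vb (v : {ffun 'I_k.+1 -> 'I_n}) (l : 'I_k) := v (lift ord0 l).
have -> : cE (fun w => \tr (\prod_(l < k) letter n w l)) =
    cE (fun w => \sum_(v : {ffun 'I_k.+1 -> 'I_n} | v ord0 == v ord_max)
      ((\prod_l fixed_factor (va v l) (vb v l) l) *
       \prod_l random_factor letter_copy eps B (va v) (vb v) l w)).
  apply: eq_cexpectation => w; rewrite mxtrace_paths; apply: eq_bigr => v _.
  rewrite -big_split /=; apply: eq_bigr => l _.
  exact: (letterE w (va v) (vb v) l).
have cR v : finite_cmoments P (fun w => \prod_l random_factor letter_copy eps B (va v) (vb v) l w).
  apply: finite_cmoments_prod => l _.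
  exact: (finite_cmoments_random_factor hB letter_copy eps hcopies (va v) (vb v) l).
rewrite cexpectation_sum; last first.
  by move=> v _; apply: finite_cmomentsM => //; exact: finite_cmoments_cst.
rewrite mulr_sumr; apply: eq_bigr => v vv.
rewrite cexpectationZ//.
rewrite (random_factor_expectation hB hcopies (J := path_disp letter_reflects eps v)); last first.
  move=> t; rewrite /letter_copy /path_disp /disp /letter_reflects /sgnd /va /vb.
  by case: (word t) => [[c|c]|] //= _; case: (eps t) => //; rewrite opprB.
rewrite mulrCA /random_count; congr (_ * _); rewrite /path_weight.
have lowE t : low letter_reflects eps n (v ord0)%:Z (path_disp letter_reflects eps v) t =
    ((va v t).+1 + (vb v t).+1 <= n)%N.
  rewrite /low; have := pos_path letter_reflects eps v (widen_ord (leqnSn k) t).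
  have := pos_path letter_reflects eps v (lift ord0 t).
  rewrite -[X in pos _ _ _ _ _ X]/(t.+1) => -> /= ->; rewrite /va /vb; lia.
congr (_ * _); last by congr block_expectation; apply/funext => t; rewrite lowE.
rewrite [LHS](bigID (fun t => isSome (letter_copy t))) /= big1 ?mul1r; last first.
  by move=> t; rewrite /fixed_factor; case: (letter_copy t).
apply: eq_bigr => t rt; rewrite lowE /fixed_factor.
by case: (letter_copy t) rt.
Qed.

Lemma phi_letters_cconverges : cconverges (fun n => phi P (fun w => \prod_(l < k) letter n w l)).
Proof.
have cv := word_average_cconverges hB hs letter_reflects eps letter_copy letter_coefs_bounded.
by apply: (cconverges_eventually (N := 1) _ cv) => n n0; exact: phi_word_average.
Qed.

End Words.

Lemma joint_cvg_of_copies (d : measure_display) (T : measurableType d) (R : realType)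
    (P : probability T R) (x y x' y' : nat -> int -> {RV P >-> R})
    (rho1 rho2 rho3 rho4 rho5 rho6 s s' : R) (I : finType)
    (B : I -> forall n, T -> 'M[R[i]]_n) (d' d'' : I -> int -> R[i]) :
  assumption_B x y x' y' rho1 rho2 rho3 rho4 rho5 rho6 ->
  constant_second_moments x x' s s' ->
  (forall n, independent_copies P
       (fun i => B i n : T -> mx_space R n)
       (scaled_rtoeplitz x y x' y' n : T -> mx_space R n)) ->
  (forall i, abs_summable (d' i)) -> (forall i, abs_summable (d'' i)) ->
  joint_cvg P (PBD_family B (fun i n => gtoeplitz n (d' i) (d'' i))).
Proof.
move=> hB hs hc hd' hd'' k word eps _.
exact: (phi_letters_cconverges hB hs hc hd' hd'' word eps).
Qed.

(** A single matrix is an independent family of copies of itself, so the statement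
    about one Toeplitz matrix is the case of the index type unit. *)
Lemma independent_copies_single (d : measure_display) (T : measurableType d) (R : realType)
    (P : probability T R) (d' : measure_display) (S : measurableType d') (X : T -> S) :
  measurable_fun [set: T] X -> independent_copies P (fun _ : unit => X) X.
Proof.
move=> mX; split=> // s A us mA.
case: s us => [|[] [|[] s]] //= _.
  by rewrite big_nil set_nil bigcap_set0 probability_setT.
by rewrite big_seq1 set_cons1 bigcap_set1.
Qed.

Theorem theorem2 (R : realType) (d : measure_display) (T : measurableType d)
    (P : probability T R) (x y x' y' : nat -> int -> {RV P >-> R})
    (rho1 rho2 rho3 rho4 rho5 rho6 s s' : R)
    (hB : assumption_B x y x' y' rho1 rho2 rho3 rho4 rho5 rho6)
    (hs : constant_second_moments x x' s s')
    (m : nat) (B : 'I_m -> forall n, T -> 'M[R[i]]_n)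
    (hcopies : forall n, independent_copies P
       (fun i => B i n : T -> mx_space R n)
       (scaled_rtoeplitz x y x' y' n : T -> mx_space R n))
    (d' d'' : 'I_m -> int -> R[i])
    (hd' : forall i, abs_summable (d' i))
    (hd'' : forall i, abs_summable (d'' i)) :
  joint_cvg P (PBD_family B (fun i n => gtoeplitz n (d' i) (d'' i))) /\
  (forall e' e'' : int -> R[i], abs_summable e' -> abs_summable e'' ->
     joint_cvg P (PBD_family (fun _ : unit => scaled_rtoeplitz x y x' y')
                             (fun _ n => gtoeplitz n e' e''))).
Proof.
split; first exact: joint_cvg_of_copies hB hs hcopies hd' hd''.
move=> e' e'' he' he''.
apply: (joint_cvg_of_copies (I := unit) hB hs _ (fun=> he') (fun=> he'')) => n.
apply: independent_copies_single; exact: measurable_toep hB n.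
Qed.
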